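(* For all $U,b>0$ and $\mu\in(0,U)$, the sequence of stochastic processes $\{\mathcal M^T(\alpha)_{0\le\alpha\le1},\ T\ge1\}$ converges weakly, as $T\to\infty$, to the process $\mathcal M^\infty(\alpha)_{0\le\alpha\le1}$ on the space $D([0,1],\mathbb R^2)$ under the $J_1$ topology.
   Context: $D([0,1],\mathbb R^2)$ is the Skorokhod space of right-continuous functions with left limits. Intervals of index/time variables denote integer intervals. Empty products equal 1. Pre-limit. For each integer $T\ge1$: for $j\in[-1,T-1]$, $A^T_j=U\prod_{k=j+1}^{T-1}\frac{k}{b+k}$, and $A^T_T=\frac{b+T}{T}U$; for $j\in[-1,T]$, $B^T_j=\frac{j}{b+T}A^T_j$. $\Gamma^T_\mu=j+1$ if $\mu\in(A^{T+1}_j,A^{T+1}_{j+1}]$, $j\in[-1,T-1]$. $\Lambda^T=\max(T-\Gamma^T_\mu,1)$, $D^T_0=\mu$, and for $t\in[1,\Lambda^T]$: $D^T_t=A^{T+1-t}_{\min(\Gamma^T_\mu,T-1)}$, $X^T_t=B^{T+1-t}_{\Gamma^T_\mu}$ (one has $D^T_{\Lambda^T}=U$). $M^T(t)=(\mathcal X^T_t,\mathcal D^T_t)$, $t\ge1$, is the Markov chain with: $(\mathcal X^T_1,\mathcal D^T_1)=(X^T_1,D^T_1)$ with probability $\mu/D^T_1$ and $(X^T_1,0)$ with probability $1-\mu/D^T_1$; for $t\in[2,\Lambda^T]$: if $\mathcal D^T_{t-1}=0$ then $(\mathcal X^T_t,\mathcal D^T_t)=(\mathcal X^T_{t-1},0)$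 with probability 1; if $\mathcal D^T_{t-1}\ne0$ then $(\mathcal X^T_t,\mathcal D^T_t)=(X^T_t,D^T_t)$ with probability $D^T_{t-1}/D^T_t$ and $(X^T_t,0)$ with probability $1-D^T_{t-1}/D^T_t$; for $t\ge\Lambda^T+1$: $(\mathcal X^T_t,\mathcal D^T_t)=(\mathcal X^T_{\Lambda^T},0)$ if $\mathcal D^T_{\Lambda^T}=0$, and $=(U,U)$ if $\mathcal D^T_{\Lambda^T}=U$. For $\alpha\in[0,1]$, $\mathcal M^T(\alpha)=M^T(\max(\lfloor\alpha T\rfloor,1))$. Limit. $\gamma=\mu/U$, $\Lambda^\infty=1-\gamma^{1/b}$. $Z^\infty$ is a random variable with density $b(1-\alpha)^{b-1}$ on $[0,\Lambda^\infty)$ and an atom of mass $\gamma$ at $\Lambda^\infty$. For $\alpha\in[0,\Lambda^\infty]$, $D^\infty_\alpha=\mu(1-\alpha)^{-b}$ and $X^\infty_\alpha=\mu\gamma^{1/b}(1-\alpha)^{-(b+1)}$. For $\alpha\in[0,1]$, $$\mathcal M^\infty(\alpha)=\begin{cases}(X^\infty_\alpha,D^\infty_\alpha)&\alpha\in[0,Z^\infty),\\(X^\infty_{Z^\infty},0)&\alpha\ge Z^\infty\text{ and }Z^\infty<\Lambda^\infty,\\(U,U)&\alpha\ge Z^\infty\text{ and }Z^\infty=\Lambda^\infty.\end{cases}$$ *)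

(* Defs.v *)
(* MathComp-Analysis *)
From HB Require Import structures.
From mathcomp Require Import all_boot all_order all_algebra.
From mathcomp Require Import all_classical all_reals all_analysis.
Set Implicit Arguments.
Unset Strict Implicit.
Unset Printing Implicit Defensive.
Import Order.TTheory GRing.Theory Num.Theory.
Import numFieldNormedType.Exports.
Local Open Scope classical_set_scope.
Local Open Scope ring_scope.

Definition cadlag {R : realType} {V : topologicalType} (x : R -> V) : Prop :=
  (forall t : R, 0 <= t < 1 -> x s @[s --> t^'+] --> x t) /\
  (forall t : R, 0 < t <= 1 -> exists l : V, x s @[s --> t^'-] --> l).

(* Paths are functions on R normalised to vanish outside [0, 1], so that Leibniz
   equality of paths is equality on [0, 1]. *)
Record skorokhod (R : realType) (V : normedModType R) := Skorokhod {
  skorokhod_fun :> R -> V ;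
  skorokhod_cadlag : cadlag skorokhod_fun ;
  skorokhod_out : forall t, t \notin `[0, 1] -> skorokhod_fun t = 0 }.

Section skorokhod_of_fun.
Context {R : realType} {V : normedModType R}.

Lemma cadlag_eq01 (x y : R -> V) :
  {in `[0, 1], x =1 y} -> cadlag x -> cadlag y.
Proof.
move=> xy [xr xl]; split=> t /andP[t0 t1].
- rewrite -xy ?in_itv/= ?t0 ?(ltW t1)//.
  apply: cvg_trans (xr t _); last by rewrite t0 t1.
  apply: near_eq_cvg; near=> s; apply: xy; rewrite in_itv/=; apply/andP; split.
    by apply: le_trans t0 _; near: s; exact: nbhs_right_ge.
  by near: s; apply: nbhs_right_ltW.
- have [l xtl] := xl t ltac:(by rewrite t0 t1).
  exists l; apply: cvg_trans xtl.
  apply: near_eq_cvg; near=> s; apply: xy; rewrite in_itv/=; apply/andP; split.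
    by apply: ltW; near: s; exact: nbhs_left_gt.
  by apply: le_trans _ t1; near: s; exact: nbhs_left_le.
Unshelve. all: by end_near. Qed.

Definition restr01 (x : R -> V) (t : R) : V := if t \in `[0, 1] then x t else 0.

Lemma restr01_cadlag (x : R -> V) : cadlag x -> cadlag (restr01 x).
Proof. by apply: cadlag_eq01 => t t01; rewrite /restr01 t01. Qed.

Lemma restr01_out (x : R -> V) t : t \notin `[0, 1] -> restr01 x t = 0.
Proof. by move=> t01; rewrite /restr01 (negbTE t01). Qed.

Definition skorokhod_of (x : R -> V) (cx : cadlag x) : skorokhod V :=
  Skorokhod (restr01_cadlag cx) (@restr01_out x).

End skorokhod_of_fun.

Definition time_change {R : realType} (l : R -> R) : Prop :=
  [/\ {in `[0, 1] &, {homo l : s t / s < t}},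
      {within `[0, 1], continuous l} &
      l @` `[0, 1] = `[0, 1]%classic].

(* J1_ball x e y says d(x, y) < e for the J1 distance
     d(x, y) = inf_l max(sup_t |l t - t|, sup_t |x t - y (l t)|),
   where l ranges over the time changes and t over [0, 1]. *)
Definition J1_ball {R : realType} {V : normedModType R}
    (x : skorokhod V) (e : R) (y : skorokhod V) : Prop :=
  exists2 l : R -> R, time_change l &
  exists2 r, r < e &
    forall t, t \in `[0, 1] -> `|l t - t| <= r /\ `|x t - y (l t)| <= r.

Section J1_topology.
Context {R : realType} {V : normedModType R}.
Implicit Types (x y z : skorokhod V) (l m : R -> R).

Lemma time_change_mem l t : time_change l -> t \in `[0, 1] -> l t \in `[0, 1].
Proof.
move=> [_ _ l01] t01.
have : (`[0, 1]%classic : set R) (l t) by rewrite -l01; exists t.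
by [].
Qed.

Lemma incr_onto_time_change l : {in `[0, 1] &, {homo l : s t / s < t}} ->
  l @` `[0, 1] = `[0, 1]%classic -> time_change l.
Proof.
move=> lh l01; split => //.
have lm : {in `[0, 1] &, {mono l : s t / s <= t}} by exact: le_mono_in.
have i0 : (0 : R) \in `[0, 1] by rewrite in_itv/= lexx ler01.
have i1 : (1 : R) \in `[0, 1] by rewrite in_itv/= lexx ler01.
have mem t : t \in `[0, 1] -> l t \in `[0, 1].
  move=> t01; have : (`[0, 1]%classic : set R) (l t) by rewrite -l01; exists t.
  by [].
have sur t : t \in `[0, 1] -> exists2 s, s \in `[0, 1] & l s = t.
  move=> t01; have : (l @` `[0, 1]) t by rewrite l01.
  by move=> [s s01 <-]; exists s.
have l0 : l 0 = 0.
  apply/eqP; rewrite eq_le; apply/andP; split; last first.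
    by have := mem _ i0; rewrite in_itv/= => /andP[].
  have [s s01 ls] := sur _ i0.
  by rewrite -[leRHS]ls lm//; move: s01; rewrite in_itv/= => /andP[].
have l1 : l 1 = 1.
  apply/eqP; rewrite eq_le; apply/andP; split.
    by have := mem _ i1; rewrite in_itv/= => /andP[].
  have [s s01 ls] := sur _ i1.
  by rewrite -[leLHS]ls lm//; move: s01; rewrite in_itv/= => /andP[].
apply: segment_inc_surj_continuous => //.
by rewrite l0 l1 => t /= t01; have [s s01 <-] := sur _ t01; exists s.
Qed.

Lemma J1_ball_center x (e : R) : 0 < e -> J1_ball x e x.
Proof.
move=> e0; exists id.
  by apply: incr_onto_time_change; [by []|rewrite image_id].
by exists 0 => // t _; rewrite !subrr !normr0.
Qed.

Lemma time_change_inv l : time_change l -> exists2 m, time_change m &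
  forall t, t \in `[0, 1] -> m t \in `[0, 1] /\ l (m t) = t.
Proof.
move=> tl; have [lh _ l01] := tl.
have lm : {in `[0, 1] &, {mono l : s t / s <= t}} by exact: le_mono_in.
have ltm : {in `[0, 1] &, {mono l : s t / s < t}} by exact: leW_mono_in.
have linj : {in `[0, 1] &, injective l} by exact: inc_inj_in.
have /choice[m mP] : forall t, exists s : R, t \in `[0, 1] ->
    s \in `[0, 1] /\ l s = t.
  move=> t; have [t01|nt] := boolP (t \in `[0, 1]); last by exists 0.
  have : (l @` `[0, 1]) t by rewrite l01.
  by move=> [s s01 <-]; exists s.
exists m; last exact: mP.
apply: incr_onto_time_change.
  move=> s t s01 t01 st.
  have [ms els] := mP _ s01; have [mt elt] := mP _ t01.
  by rewrite -ltm// els elt.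
apply/seteqP; split=> [_ [t t01 <-]|t t01]; first by have [] := mP _ t01.
have lt01 := time_change_mem tl t01.
by exists (l t) => //; have [? ?] := mP _ lt01; exact: linj.
Qed.

Lemma J1_ball_sym x y (e : R) : J1_ball x e y -> J1_ball y e x.
Proof.
move=> [l tl [r re lr]]; have [m tm mP] := time_change_inv tl.
exists m => //; exists r => // t t01; have [m01 lmt] := mP _ t01.
have [h1 h2] := lr _ m01; rewrite lmt in h1 h2.
by rewrite distrC h1 distrC h2.
Qed.

Lemma J1_ball_triangle x y z (e1 e2 : R) :
  J1_ball x e1 y -> J1_ball y e2 z -> J1_ball x (e1 + e2) z.
Proof.
move=> [l tl [r re lr]] [m tm [q qe mq]].
exists (m \o l).
  apply: incr_onto_time_change.
    move=> s t s01 t01 st; have [lh _ _] := tl; have [mh _ _] := tm.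
    by apply: mh; [exact: time_change_mem|exact: time_change_mem|exact: lh].
  have [_ _ l01] := tl; have [_ _ m01] := tm.
  by rewrite -image_comp l01.
exists (r + q); first exact: ltrD.
move=> t t01 /=; have [a1 a2] := lr _ t01.
have [b1 b2] := mq _ (time_change_mem tl t01).
split.
  rewrite -(subrKA (l t)) addrC; apply: le_trans (ler_normD _ _) _.
  by rewrite lerD // addrC.
rewrite -(subrKA (y (l t))); apply: le_trans (ler_normD _ _) _.
exact: lerD.
Qed.

HB.instance Definition _ := gen_eqMixin (skorokhod V).
HB.instance Definition _ := gen_choiceMixin (skorokhod V).

Lemma cadlag_cst (v : V) : cadlag (cst v : R -> V).
Proof. by split=> t _; [|exists v]; exact: cvg_cst. Qed.

HB.instance Definition _ := isPointed.Build (skorokhod V)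
  (skorokhod_of (cadlag_cst (0 : V))).

HB.instance Definition _ := hasNbhs.Build (skorokhod V)
  (nbhs_ball_ (@J1_ball R V)).

Lemma J1_nbhsE :
  (nbhs : skorokhod V -> _) = nbhs_ (entourage_ (@J1_ball R V)).
Proof.
rewrite /nbhs_ entourage_E predeq2E => x A; split.
  move=> [e egt0 sbeA].
  exists [set xy | J1_ball xy.1 e xy.2]; first by exists e.
  by move=> r /xsectionP; exact: sbeA.
by move=> [E [e egt0 sbeE] sEA]; exists e => // ? ?; exact/sEA/xsectionP/sbeE.
Qed.

HB.instance Definition _ := Nbhs_isPseudoMetric.Build R (skorokhod V)
  J1_nbhsE J1_ball_center J1_ball_sym J1_ball_triangle erefl.

End J1_topology.

Definition borel_measurable {d} {Omega : measurableType d}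
    {S : ptopologicalType} (Y : Omega -> S) : Prop :=
  measurable_fun [set: Omega] (Y : Omega -> g_sigma_algebraType (@open S)).

Definition weak_cvg {R : realType} {S : ptopologicalType}
    {d : nat -> measure_display} {Omega : forall n, measurableType (d n)}
    (P : forall n, probability (Omega n) R) (Y : forall n, Omega n -> S)
    {d' : measure_display} {Omega' : measurableType d'}
    (P' : probability Omega' R) (Y' : Omega' -> S) : Prop :=
  [/\ forall n, borel_measurable (Y n),
      borel_measurable Y' &
      forall f : S -> R, continuous f -> (exists C, forall s, `|f s| <= C) ->
        'E_(P n)[f \o Y n]%E @[n --> \oo] --> 'E_P'[f \o Y']%E].

Section prelimit.
Context {R : realType}.
Variables (U b mu : R) (T : nat).

(* Meant for -1 <= j <= n: the factor k = 0 makes preA n (-1) = 0. *)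
Definition preA (n : nat) (j : int) : R :=
  if j == n%:Z then (b + n%:R) / n%:R * U
  else U * \prod_(absz (j + 1) <= k < n) (k%:R / (b + k%:R)).

Definition preB (n : nat) (j : int) : R := j%:~R / (b + n%:R) * preA n j.

(* The intervals ]preA T.+1 (g - 1), preA T.+1 g], 0 <= g <= T, partition ]0, U],
   so for 0 < mu < U exactly one g is eligible; see preGammaP. *)
Definition preGamma : nat :=
  if [pick g : 'I_T.+1 | preA T.+1 (g%:Z - 1) < mu <= preA T.+1 g%:Z]
  is Some g then g else 0%N.

Definition preLambda : nat := maxn (T - preGamma) 1.

Definition preD (t : nat) : R :=
  if t == 0%N then mu else preA (T.+1 - t) (minn preGamma T.-1)%:Z.

Definition preX (t : nat) : R := preB (T.+1 - t) preGamma%:Z.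

Definition two_point (p : R) (x y : R * R) (A : set (R * R)) : \bar R :=
  (p%:E * \d_x A + (1 - p)%:E * \d_y A)%E.

Definition pre_init : set (R * R) -> \bar R :=
  two_point (mu / preD 1) (preX 1, preD 1) (preX 1, 0).

Definition pre_trans (t : nat) (x : R * R) : set (R * R) -> \bar R :=
  if x.2 == 0 then \d_((x.1, 0) : R * R)
  else two_point (preD t.-1 / preD t) (preX t, preD t) (preX t, 0).

(* M t is used for t >= 1 only.  The third clause says that, for 2 <= t <= Lambda,
   the conditional law of M t given M 1, ..., M (t - 1) is
   pre_trans t (M (t - 1)). *)
Definition is_chain {d} {Omega : measurableType d} (P : probability Omega R)
    (M : nat -> Omega -> R * R) : Prop :=
  [/\ forall t, (1 <= t)%N -> measurable_fun [set: Omega] (M t),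
      forall A, measurable A -> P (M 1%N @^-1` A) = pre_init A,
      forall t, (2 <= t <= preLambda)%N ->
        forall A : nat -> set (R * R), (forall i, measurable (A i)) ->
        P (\bigcap_(i in [set i | (1 <= i <= t)%N]) M i @^-1` A i) =
        (\int[P]_(w in \bigcap_(i in [set i | (1 <= i < t)%N]) M i @^-1` A i)
           pre_trans t (M t.-1 w) (A t))%E &
      forall t, (preLambda.+1 <= t)%N -> {ae P, forall w,
        ((M preLambda w).2 = 0 -> M t w = ((M preLambda w).1, 0)) /\
        ((M preLambda w).2 = U -> M t w = (U, U))}].

(* Num.truncn is the floor, as a natural number, since a is nonnegative. *)
Definition pre_fun (m : nat -> R * R) (a : R) : R * R :=
  m (maxn (Num.truncn (a * T%:R)) 1).

Lemma pre_fun_cadlag (m : nat -> R * R) : cadlag (pre_fun m).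
Proof.
have [T0|T0] := posnP T.
  have -> : pre_fun m = cst (m 1%N).
    apply/funext => a; rewrite /pre_fun T0 mulr0.
    by rewrite (_ : Num.truncn 0 = 0%N)// (@natrK R 0).
  exact: cadlag_cst.
have TR : 0 < T%:R :> R by rewrite ltr0n.
split=> t /andP[t0 t1].
- have tT0 : 0 <= t * T%:R by rewrite mulr_ge0// ltW.
  have /andP[h1 h2] := truncn_itv tT0.
  have h3 : t < (Num.truncn (t * T%:R)).+1%:R / T%:R by rewrite ltr_pdivlMr.
  apply: cvg_near_cst; near=> s; rewrite /pre_fun.
  suff -> : Num.truncn (s * T%:R) = Num.truncn (t * T%:R) by [].
  apply: truncn_def; apply/andP; split.
    by apply: le_trans h1 _; rewrite ler_pM2r.
  by rewrite -ltr_pdivlMr//; near: s; exact: nbhs_right_lt.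
- set n := Num.truncn (t * T%:R).
  have tT0 : 0 < t * T%:R by rewrite mulr_gt0.
  have /andP[h1 h2] := truncn_itv (ltW tT0); rewrite -/n in h1 h2.
  have [k kt tk] : exists2 k : nat, k%:R < t * T%:R & t * T%:R <= k.+1%:R.
    move: h1; rewrite le_eqVlt => /orP[/eqP nE|nlt].
      have n0 : (0 < n)%N by rewrite -(ltr0n R) nE.
      by exists n.-1; rewrite ?prednK// -nE ?ltr_nat ?prednK.
    by exists n => //; exact: ltW.
  have kt' : k%:R / T%:R < t by rewrite ltr_pdivrMr.
  exists (m (maxn k 1)).
  apply: cvg_near_cst; near=> s; rewrite /pre_fun.
  suff -> : Num.truncn (s * T%:R) = k by [].
  apply: truncn_def; apply/andP; split.
    by rewrite -ler_pdivrMr//; apply: ltW; near: s; exact: nbhs_left_gt.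
  by apply: lt_le_trans tk; rewrite ltr_pM2r.
Unshelve. all: by end_near. Qed.

Definition pre_path (m : nat -> R * R) : skorokhod (R * R)%type :=
  skorokhod_of (pre_fun_cadlag m).

End prelimit.

Lemma preGammaP (R : realType) (U b mu : R) (T : nat) : 0 < mu < U ->
  (preGamma U b mu T <= T)%N /\
  preA U b T.+1 ((preGamma U b mu T)%:Z - 1) < mu
    <= preA U b T.+1 (preGamma U b mu T)%:Z.
Proof.
move=> /andP[mu0 muU]; rewrite /preGamma; case: pickP => [g hg|nog].
  by split=> //; rewrite -ltnS.
exfalso.
have exg : exists g, (g <= T)%N && (mu <= preA U b T.+1 g%:Z).
  exists T; rewrite leqnn /= /preA eqz_nat ltn_eqF//.
  by rewrite -PoszD addn1 /= big_geq// mulr1 ltW.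
have [g /andP[gT gmu] gmin] := ex_minnP exg.
have := nog (Ordinal (gT : (g < T.+1)%N)); rewrite /= gmu andbT => /negP; apply.
case: g gT gmu gmin => [|g] gT gmu gmin.
  by rewrite /preA /= big_ltn// mul0r mul0r mulr0.
have -> : g.+1%:Z - 1 = g%:Z by rewrite -addn1 PoszD addrK.
rewrite ltNge; apply/negP => h.
by have := gmin g; rewrite h (ltnW gT) ltnn => /(_ isT).
Qed.

Section limit.
Context {R : realType}.
Variables (U b mu : R).

Definition limGamma : R := mu / U.
Definition limLambda : R := 1 - limGamma `^ b^-1.
Definition limitD (a : R) : R := mu * (1 - a) `^ (- b).
Definition limitX (a : R) : R := mu * limGamma `^ b^-1 * (1 - a) `^ (- (b + 1)).

Definition Z_law (A : set R) : \bar R :=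
  (\int[lebesgue_measure]_(a in A `&` `[0%R, limLambda[%classic)
      (b * (1 - a) `^ (b - 1))%:E
   + limGamma%:E * \d_limLambda A)%E.

(* Used for 0 <= z <= limLambda only; the last branch is then z = limLambda. *)
Definition lim_fun (z a : R) : R * R :=
  if a < z then (limitX a, limitD a)
  else if z < limLambda then (limitX z, 0) else (U, U).

Lemma limLambda_lt1 : 0 < U -> 0 < mu -> limLambda < 1.
Proof.
by move=> U0 mu0; rewrite /limLambda ltrBlDr ltrDl powR_gt0// /limGamma divr_gt0.
Qed.

Lemma cvg_limitXD (t : R) : t < 1 ->
  (limitX a, limitD a) @[a --> t] --> (limitX t, limitD t).
Proof.
move=> t1.
have cp p : (fun a : R => (1 - a) `^ p) a @[a --> t] --> (1 - t) `^ p.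
  have t0 : 0 < 1 - t by rewrite subr_gt0.
  apply: (@cvg_comp _ _ _ (fun a : R => 1 - a) (fun a => a `^ p) _
    (nbhs (1 - t))); first by apply: cvgB; [exact: cvg_cst|exact: cvg_id].
  have /derivable1_diffP/differentiable_continuous :
    derivable (fun a : R => a `^ p) (1 - t) 1.
    by apply: derivable_powR; rewrite in_itv/= t0.
  exact.
apply: (@cvg_pair _ _ _ _ (nbhs (limitX t)) (nbhs (limitD t))).
  by apply: cvgM; [exact: cvg_cst|exact: cp].
by apply: cvgM; [exact: cvg_cst|exact: cp].
Qed.

Lemma lim_fun_cadlag (z : R) : 0 < U -> 0 < mu ->
  0 <= z <= limLambda -> cadlag (lim_fun z).
Proof.
move=> U0 mu0 /andP[z0 zL].
have z1 : z < 1 := le_lt_trans zL (limLambda_lt1 U0 mu0).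
split=> t /andP[t0 t1].
- have [tz|zt] := ltP t z.
    have ct := @cvg_limitXD t t1.
    have -> : lim_fun z t = (limitX t, limitD t) by rewrite /lim_fun tz.
    apply: cvg_trans (cvg_at_right_filter ct).
    by apply: near_eq_cvg; near=> s; rewrite /lim_fun ifT.
  apply: cvg_near_cst; near=> s; rewrite /lim_fun.
  have ts : t < s by near: s; exact: nbhs_right_gt.
  by rewrite !ltNge zt (le_trans zt (ltW ts)).
- have [tz|zt] := leP t z.
    have ct := @cvg_limitXD t (le_lt_trans tz z1).
    exists (limitX t, limitD t).
    apply: cvg_trans (cvg_at_left_filter ct).
    apply: near_eq_cvg; near=> s; rewrite /lim_fun ifT//.
    by apply: lt_le_trans tz; near: s; exact: nbhs_left_lt.
  exists (lim_fun z t).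
  apply: cvg_near_cst; near=> s; rewrite /lim_fun.
  have ts : z < s by near: s; exact: nbhs_left_gt.
  by rewrite !ltNge (ltW ts) (ltW zt).
Unshelve. all: by end_near. Qed.

Definition lim_path (U0 : 0 < U) (mu0 : 0 < mu) (z : R)
    (z0L : 0 <= z <= limLambda) : skorokhod (R * R)%type :=
  skorokhod_of (lim_fun_cadlag U0 mu0 z0L).

End limit.

(* Main.v *)
Require Import Defs.
From HB Require Import structures.
From mathcomp Require Import all_boot all_order all_algebra.
From mathcomp Require Import all_classical all_reals all_analysis.
From mathcomp Require Import measurable_realfun.
From mathcomp Require Import ring lra zify.
Set Implicit Arguments.
Unset Strict Implicit.
Unset Printing Implicit Defensive.
Import Order.TTheory GRing.Theory Num.Theory.
Import numFieldNormedType.Exports.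
Local Open Scope classical_set_scope.
Local Open Scope ring_scope.

(** Along a trajectory of the pre-limit chain everything is deterministic except
the step at which the second coordinate drops to zero: by the transition
probabilities [preD t.-1 / preD t] the chain is still alive after step [t] with
probability [mu / preD t], and its survival probability at the last step is
[mu / U], which is the mass of the atom of [Z].  So the chain almost surely
follows one of finitely many explicit trajectories ([scenario]), the one jumping
at step [k] having probability [mu / preD k.-1 - mu / preD k]
([probability_follows], [follows_forever]).

The limit has the same structure, and the two are compared on the probability
space of [Z].  Let [lim_time t] be the time at which [limitD] takes the value
[preD t].  For [a] in [[0, limLambda]], [Z] is at least [a] with
probability [(1 - a) `^ b = mu / limitD a], so the event that [Z] lies between [lim_time k.-1] and
[lim_time k] has exactly the probability of the scenario [k].  Playing the
scenario [k] on this event ([coupled]) therefore reproduces the law of the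
pre-limit path without any error ([expectation_coupled]), and weak convergence
becomes almost sure convergence plus dominated convergence
([cvg_expectation_coupled]).

Almost sure convergence needs two estimates, uniform in [t]: [lim_time t] is
close to [t / T], and [preX t] is close to [limitX (lim_time t)]; the second
coordinates agree by the choice of [lim_time].  Both follow from
[\prod_(m <= k < n) k / (b + k) = (m / n) `^ b * expR (O (1 / m))]
([ln_ratio_prod]) once [preGamma] is known to tend to infinity
([prelimit_near]).  A scenario jumping at step [k] is then matched to the limit
path jumping at [Z] by the piecewise linear time change carrying [k / T] to [Z]
([J1_ball_killed]).  In the scenario without jump the limit path is continuous
and no time change is needed ([J1_ball_alive]).  The time [Z = 0] is
exceptional, because the limit path then starts at its value after the jump,
but it has probability zero.

Borel measurability for the J1 topology is proved directly: the pre-limit path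
depends continuously on finitely many pairs of reals, and the limit path depends
continuously on [Z] strictly between [0] and [limLambda]. *)

(** * Products of ratios k / (b + k) *)

Section elementary.
Context {R : realType}.

Lemma expR_lip (x y : R) : x <= 0 -> y <= 0 -> `|expR x - expR y| <= `|x - y|.
Proof.
wlog xy : x y / x <= y => [h x0 y0|_ y0].
  have [xy|/ltW yx] := leP x y; first exact: h.
  by rewrite distrC (distrC x); exact: h.
rewrite distrC (distrC x) !ger0_norm ?subr_ge0 ?ler_expR//.
have -> : expR x = expR y * expR (x - y) by rewrite -expRD addrC subrK.
have e1 := expR_ge1Dx (x - y).
have e2 : expR y <= 1 by rewrite -expR0 ler_expR.
have e3 := expR_gt0 y.
have e4 : expR (x - y) <= 1 by rewrite -expR0 ler_expR subr_le0.
nra.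
Qed.

Lemma ln_lip (c x y : R) : 0 < c -> c <= x -> c <= y ->
  `|ln x - ln y| <= `|x - y| / c.
Proof.
move=> c0; wlog xy : x y / x <= y => [h cx cy|cx _].
  have [xy|/ltW yx] := leP x y; first exact: h.
  by rewrite distrC (distrC x); exact: h.
have x0 := lt_le_trans c0 cx; have y0 := lt_le_trans x0 xy.
rewrite distrC (distrC x) !ger0_norm ?subr_ge0 ?ler_ln ?posrE//.
rewrite -ln_div ?posrE//.
have -> : y / x = 1 + (y - x) / x by field; rewrite gt_eqF.
apply: le_trans (le_ln1Dx _) _.
  by apply: lt_le_trans (ltrN10 _) _; rewrite divr_ge0 ?subr_ge0// ltW.
by rewrite ler_wpM2l ?subr_ge0// lef_pV2 ?posrE.
Qed.

(** Both bounds come from [ln (1 + y) <= y], applied to [y = x] and to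
[y = - x / (1 + x)]. *)
Lemma ln1D_err (x : R) : 0 <= x -> `|ln (1 + x) - x| <= x ^+ 2.
Proof.
move=> x0; have x1 : 0 < 1 + x by lra.
have up : ln (1 + x) <= x by apply: le_ln1Dx; lra.
have lo : - (x / (1 + x)) >= - ln (1 + x).
  rewrite -lnV ?posrE// [X in ln X](_ : _ = 1 + - (x / (1 + x))); last first.
    by field; rewrite gt_eqF.
  by apply: le_ln1Dx; rewrite ltrN2 ltr_pdivrMr//; lra.
have : x - x / (1 + x) <= x ^+ 2.
  rewrite (_ : x - _ = x ^+ 2 / (1 + x)); last by field; rewrite gt_eqF.
  by rewrite ler_pdivrMr//; nra.
by move=> h; rewrite ler_norml; apply/andP; split; lra.
Qed.

(** The first-order terms [- b / k] and [b / k] of the two logarithms cancel; the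
quadratic error is dominated by [k^-1 - k.+1^-1] so that it telescopes. *)
Lemma ln_ratio_err (b : R) (k : nat) : 0 < b -> (0 < k)%N ->
  `|ln (k%:R / (b + k%:R)) + b * (ln k.+1%:R - ln k%:R)|
    <= 2 * (b + b ^+ 2) * (k%:R^-1 - k.+1%:R^-1).
Proof.
move=> b0 k0; have kR : 0 < k%:R :> R by rewrite ltr0n.
have k1 : 1 <= k%:R :> R by rewrite ler1n.
set x : R := k%:R in kR k1 *.
have -> : k.+1%:R = 1 + x :> R by rewrite -natr1 addrC.
have -> : ln (x / (b + x)) = - ln (1 + b / x).
  rewrite -lnV ?posrE; last by rewrite addr_gt0// divr_gt0.
  by congr ln; field; rewrite !gt_eqF//=; lra.
have -> : ln (1 + x) - ln x = ln (1 + x^-1).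
  rewrite -ln_div ?posrE//; last by lra.
  by congr ln; field; rewrite gt_eqF.
have bx : 0 <= b / x by rewrite divr_ge0// ltW.
have ix : 0 <= x^-1 by rewrite invr_ge0 ltW.
have -> : 2 * (b + b ^+ 2) * (x^-1 - (1 + x)^-1)
     = (b + b ^+ 2) * x^-1 ^+ 2 * (2 * (x / (1 + x))).
  by field; rewrite !gt_eqF//=; lra.
have hx : 1 <= 2 * (x / (1 + x)) by rewrite mulrA ler_pdivlMr; lra.
have h5 : b * `|ln (1 + x^-1) - x^-1| <= b * x^-1 ^+ 2.
  by rewrite ler_pM2l//; exact: ln1D_err.
have h6 := ln1D_err bx.
apply: (@le_trans _ _ ((b + b ^+ 2) * x^-1 ^+ 2)).
  rewrite [X in `|X|](_ : _ = b * (ln (1 + x^-1) - x^-1) - (ln (1 + b / x) - b / x)).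
    apply: le_trans (ler_normB _ _) _; rewrite normrM (gtr0_norm b0) mulrDl.
    by apply: lerD; [exact: h5|rewrite -exprMn].
  by ring.
rewrite ler_peMr// mulr_ge0 ?sqr_ge0//; nra.
Qed.

Definition ratio_prod (b : R) (m n : nat) : R :=
  \prod_(m <= k < n) (k%:R / (b + k%:R)).

Lemma ratio_prod_gt0 b m n : 0 < b -> (0 < m)%N -> 0 < ratio_prod b m n.
Proof.
move=> b0 m0; rewrite /ratio_prod big_nat; apply: prodr_gt0 => k /andP[mk _].
have k0 : 0 < k%:R :> R by rewrite ltr0n (leq_trans m0 mk).
by rewrite divr_gt0// addr_gt0.
Qed.

Lemma ratio_prodSr b m n : (m <= n)%N ->
  ratio_prod b m n.+1 = ratio_prod b m n * (n%:R / (b + n%:R)).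
Proof. by move=> mn; rewrite /ratio_prod big_nat_recr. Qed.

(** The product behaves like [(m / n) `^ b] with a multiplicative error that is
small as soon as [m] is large, whatever [n]. *)
Lemma ln_ratio_prod b m n : 0 < b -> (0 < m)%N -> (m <= n)%N ->
  `|ln (ratio_prod b m n) + b * (ln n%:R - ln m%:R)|
    <= 2 * (b + b ^+ 2) * (m%:R^-1 - n%:R^-1).
Proof.
move=> b0 m0; elim: n => [|n IH]; first by rewrite leqn0 => /eqP m00; rewrite m00 in m0.
rewrite leq_eqVlt => /orP[/eqP <-|].
  by rewrite /ratio_prod big_geq// ln1 !subrr !mulr0 addr0 normr0.
rewrite ltnS => mn; have n0 := leq_trans m0 mn.
rewrite ratio_prodSr// lnM ?posrE ?ratio_prod_gt0//; last first.
  by rewrite divr_gt0 ?addr_gt0// ltr0n.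
have := IH mn; have := ln_ratio_err b0 n0.
set C := 2 * _; move=> h1 h2.
rewrite (_ : C * _ = C * (m%:R^-1 - n%:R^-1) + C * (n%:R^-1 - n.+1%:R^-1)); last by ring.
rewrite [X in `|X|](_ : _ = (ln (ratio_prod b m n) + b * (ln n%:R - ln m%:R)) +
  (ln (n%:R / (b + n%:R)) + b * (ln n.+1%:R - ln n%:R))); last by ring.
exact: le_trans (ler_normD _ _) (lerD h2 h1).
Qed.

Lemma ratio_prod_weak b m n : 0 < b -> (0 < m)%N -> (m <= n)%N ->
  `|ln (ratio_prod b m n) + b * (ln n%:R - ln m%:R)| <= 2 * (b + b ^+ 2) / m%:R.
Proof.
move=> b0 m0 mn; apply: le_trans (ln_ratio_prod b0 m0 mn) _.
rewrite ler_wpM2l//; first by nra.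
by rewrite gerBl invr_ge0.
Qed.

End elementary.

(** * The pre-limit values on the time scale of the limit *)

Section prelimit_values.
Context {R : realType}.
Variables (U b mu : R).
Hypotheses (U_gt0 : 0 < U) (b_gt0 : 0 < b) (mu_gt0 : 0 < mu) (mu_ltU : mu < U).

Let muU : 0 < mu < U. Proof. by rewrite mu_gt0. Qed.

Lemma preA_ratio_prod (n j : nat) : (j < n)%N ->
  preA U b n j%:Z = U * ratio_prod b j.+1 n.
Proof. by move=> jn; rewrite /preA eqz_nat ltn_eqF// -PoszD addn1 absz_nat. Qed.

Lemma mu_le_Gamma T : mu <= U * ratio_prod b (preGamma U b mu T).+1 T.+1.
Proof.
have [gT /andP[_ h]] := preGammaP b T muU.
by rewrite -preA_ratio_prod.
Qed.

Lemma Gamma_lt_mu T : (0 < preGamma U b mu T)%N ->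
  U * ratio_prod b (preGamma U b mu T) T.+1 < mu.
Proof.
move=> g0; have [gT /andP[h _]] := preGammaP b T muU.
rewrite -[X in ratio_prod b X](prednK g0) -preA_ratio_prod//; last first.
  by rewrite prednK// (leq_trans gT).
by rewrite -subn1 -subzn.
Qed.

Section fixed_horizon.
Variable T : nat.
Notation g := (preGamma U b mu T).
Hypothesis gT : (g < T)%N.
Notation L := (preLambda U b mu T).
Notation D := (preD U b mu T).

Lemma preLambdaE : L = (T - g)%N.
Proof. by rewrite /preLambda; apply/maxn_idPl; rewrite subn_gt0. Qed.

Lemma preLambda_gt0 : (0 < L)%N.
Proof. by rewrite preLambdaE subn_gt0. Qed.

Lemma Gamma_lt_sub t : (t <= L)%N -> (g < T.+1 - t)%N.
Proof. by rewrite preLambdaE leq_subRL ?(ltnW gT)// ltn_subRL ltnS addnC. Qed.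

Lemma preDE t : (0 < t <= L)%N -> D t = U * ratio_prod b g.+1 (T.+1 - t).
Proof.
rewrite preLambdaE => /andP[t0 tL]; rewrite /preD gtn_eqF//.
have -> : minn g T.-1 = g by apply/minn_idPl; lia.
by rewrite preA_ratio_prod//; lia.
Qed.

Lemma preXE t : (0 < t <= L)%N ->
  preX U b mu T t = g%:R / (b + (T.+1 - t)%N%:R) * D t.
Proof.
move=> tL; rewrite preDE// /preX /preB preA_ratio_prod//.
by move: tL; rewrite preLambdaE; lia.
Qed.

Lemma preD0 : D 0 = mu. Proof. by []. Qed.

Lemma preD_gt0 t : (t <= L)%N -> 0 < D t.
Proof.
case: t => // t tL; rewrite preDE//.
by rewrite mulr_gt0// ratio_prod_gt0.
Qed.

Lemma preD_Lambda : D L = U.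
Proof.
rewrite preDE ?preLambda_gt0 ?leqnn// preLambdaE.
by rewrite (_ : (_ - _)%N = g.+1) ?/ratio_prod ?big_geq ?mulr1//; lia.
Qed.

Lemma ratio_le1 (k : nat) : k%:R / (b + k%:R) <= 1.
Proof. by rewrite ler_pdivrMr ?mul1r ?lerDr ?ltW// ltr_wpDr. Qed.

Lemma preD_leS t : (t < L)%N -> D t <= D t.+1.
Proof.
case: t => [|t] tL; rewrite ?preD0 [leRHS]preDE//.
  apply: le_trans (mu_le_Gamma T) _; rewrite ratio_prodSr//.
  rewrite subSS subn0 ler_pM2l// ler_piMr ?ratio_le1//.
  by rewrite ltW// ratio_prod_gt0.
rewrite preDE ?(ltnW tL)//.
move: tL; rewrite preLambdaE => tL.
rewrite (_ : (T.+1 - t.+1)%N = (T.+1 - t.+2).+1); last by lia.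
rewrite ratio_prodSr; last by lia.
by rewrite ler_pM2l// ler_piMr ?ratio_le1// ltW// ratio_prod_gt0.
Qed.

Lemma preD_le s t : (s <= t <= L)%N -> D s <= D t.
Proof.
move=> /andP[]; elim: t => [|t IH]; first by rewrite leqn0 => /eqP ->.
rewrite leq_eqVlt => /orP[/eqP -> //|]; rewrite ltnS => st tL.
exact: le_trans (IH st (ltnW tL)) (preD_leS tL).
Qed.

Lemma preD_leU t : (t <= L)%N -> D t <= U.
Proof. by move=> tL; rewrite -[leRHS]preD_Lambda preD_le// tL leqnn. Qed.

End fixed_horizon.

(** The solution [a] of [limitD a = preD t]. *)
Definition lim_time (T t : nat) : R := 1 - (mu / preD U b mu T t) `^ b^-1.

Section lim_time.
Variable T : nat.
Notation g := (preGamma U b mu T).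
Hypothesis gT : (g < T)%N.
Notation L := (preLambda U b mu T).
Notation D := (preD U b mu T).

Lemma lim_time0 : lim_time T 0 = 0.
Proof. by rewrite /lim_time preD0 divff ?gt_eqF// powR1 subrr. Qed.

Lemma lim_time_Lambda : lim_time T L = limLambda U b mu.
Proof. by rewrite /lim_time preD_Lambda. Qed.

Lemma onem_lim_time t : (t <= L)%N -> 0 < 1 - lim_time T t.
Proof.
by move=> tL; rewrite /lim_time subKr powR_gt0// divr_gt0// preD_gt0.
Qed.

(** The survival function of [Z] at [lim_time t] is the survival probability of
the chain after step [t]. *)
Lemma onem_lim_time_powR t : (t <= L)%N -> (1 - lim_time T t) `^ b = mu / D t.
Proof.
move=> tL; rewrite /lim_time subKr -powRrM mulVf ?gt_eqF//.
by rewrite powRr1// divr_ge0 ?ltW ?preD_gt0.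
Qed.

(** This exact identity is the reason for comparing the two processes at the
times [lim_time t] rather than at [t / T]. *)
Lemma limD_lim_time t : (t <= L)%N -> limitD b mu (lim_time T t) = D t.
Proof.
move=> tL; have D0 := preD_gt0 gT tL.
rewrite /limitD powRN onem_lim_time_powR// invf_div mulrC divfK// gt_eqF//.
Qed.

Lemma lim_time_le s t : (s <= t <= L)%N -> lim_time T s <= lim_time T t.
Proof.
move=> /andP[st tL]; have sL := leq_trans st tL.
have Ds := preD_gt0 gT sL; have Dt := preD_gt0 gT tL.
rewrite lerB// ge0_ler_powR ?nnegrE ?invr_ge0 ?divr_ge0 ?(ltW b_gt0) ?(ltW mu_gt0) ?(ltW Ds) ?(ltW Dt)//.
by rewrite ler_pM2l// lef_pV2 ?posrE// preD_le ?st.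
Qed.

Lemma lim_time_itv t : (t <= L)%N -> 0 <= lim_time T t <= limLambda U b mu.
Proof. move=> tL; rewrite -[X in X <= _ <= _]lim_time0 -lim_time_Lambda.
by rewrite !lim_time_le ?tL ?leqnn. Qed.

End lim_time.

End prelimit_values.

(** * Uniform asymptotics of the pre-limit values *)

Section asymptotics.
Context {R : realType}.
Variables (U b mu : R).
Hypotheses (U_gt0 : 0 < U) (b_gt0 : 0 < b) (mu_gt0 : 0 < mu) (mu_ltU : mu < U).
Notation C := (2 * (b + b ^+ 2)).

Let C_gt0 : 0 < C. Proof. by rewrite mulr_gt0 ?addr_gt0 ?exprn_gt0. Qed.

Let lnS_err (k : nat) : (0 < k)%N -> `|ln k.+1%:R - ln k%:R : R| <= k%:R^-1.
Proof.
move=> k0; have kR : 0 < k%:R :> R by rewrite ltr0n.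
apply: le_trans (ln_lip kR _ _) _ => //; first by rewrite ler_nat.
by rewrite -natrB// subSnn normr1 mul1r.
Qed.

Section fixed_horizon.
Variable T : nat.
Notation g := (preGamma U b mu T).
Hypotheses (g_gt0 : (0 < g)%N) (gT : (g < T)%N).
Notation L := (preLambda U b mu T).
Notation D := (preD U b mu T).
Notation z := (lim_time U b mu T).

Let gR : 0 < g%:R :> R. Proof. by rewrite ltr0n. Qed.
Let gV : g.+1%:R^-1 <= g%:R^-1 :> R.
Proof. by rewrite lef_pV2 ?posrE ?ltr0n// ler_nat. Qed.
Let muU0 : 0 < mu / U. Proof. exact: divr_gt0. Qed.

(** [preGamma] is the index at which the product passes the level [mu / U]; the
two products surrounding this level differ by one factor, of logarithm at most
[b / preGamma]. *)
Lemma ln_Gamma_err :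
  `|ln (mu / U) + b * (ln T.+1%:R - ln g.+1%:R)| <= (C + b) / g%:R.
Proof.
have up : ln (mu / U) <= ln (ratio_prod b g.+1 T.+1).
  rewrite ler_ln ?posrE ?ratio_prod_gt0// ler_pdivrMr// mulrC.
  exact: mu_le_Gamma.
have lo : ln (ratio_prod b g T.+1) <= ln (mu / U).
  rewrite ler_ln ?posrE ?ratio_prod_gt0// ler_pdivlMr// mulrC ltW//.
  exact: Gamma_lt_mu.
have /(ratio_prod_weak b_gt0 (ltn0Sn g)) : (g.+1 <= T.+1)%N by rewrite ltnS ltnW.
have /(ratio_prod_weak b_gt0 g_gt0) : (g <= T.+1)%N by rewrite ltnW// ltnS ltnW.
have := lnS_err g_gt0; rewrite !ler_norml.
move=> /andP[h1 h2] /andP[h3 h4] /andP[h5 h6].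
have h7 : C / g.+1%:R <= C / g%:R by rewrite ler_pM2l.
have h8 : b * (ln g.+1%:R - ln g%:R) <= b * g%:R^-1 by rewrite ler_pM2l.
have h9 : 0 <= b * g%:R^-1 by rewrite mulr_ge0 ?ltW// invr_gt0.
rewrite mulrDl; move: up lo h3 h4 h5 h6 h7 h8 h9.
set A := ln (mu / U); set B := ln (ratio_prod _ _ _); set B' := ln (ratio_prod _ _ _).
set l1 := ln _; set l2 := ln _; set l3 := ln _.
move: (_ / _) (_ / _) (_ * _^-1) => c1 c2 c3.
move=> *; apply/andP; split; nra.
Qed.

(** Dividing [mu / U] by [preD t / U] removes the factor depending on [preGamma]:
up to errors of order [1 / preGamma], what remains is
[((T.+1 - t) / T.+1) `^ b]. *)
Lemma ln_onem_lim_time_err t : (0 < t <= L)%N ->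
  `|ln (1 - z t) - (ln (T.+1 - t)%N%:R - ln T.+1%:R)| <= (2 * C + b) / b / g%:R.
Proof.
move=> /[dup] tL /andP[t0 tL']; have h := ln_Gamma_err.
have := @ratio_prod_weak _ b g.+1 (T.+1 - t) b_gt0 isT (Gamma_lt_sub gT tL').
move=> /le_trans /(_ (ler_wpM2l (ltW C_gt0) gV)) h2.
rewrite /lim_time subKr ln_powR preDE//.
rewrite (_ : mu / _ = (mu / U) / ratio_prod b g.+1 (T.+1 - t)); last first.
  by field; rewrite !gt_eqF// ratio_prod_gt0.
rewrite ln_div ?posrE ?ratio_prod_gt0//.
rewrite -(ler_pM2l b_gt0) -{1}(gtr0_norm b_gt0) -normrM.
rewrite (_ : b * (_ / g%:R) = (C + b) / g%:R + C / g%:R); last first.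
  by field; rewrite !gt_eqF.
rewrite [X in `|X|](_ : _ = (ln (mu / U) + b * (ln T.+1%:R - ln g.+1%:R)) -
  (ln (ratio_prod b g.+1 (T.+1 - t)) + b * (ln (T.+1 - t)%N%:R - ln g.+1%:R))).
  exact: le_trans (ler_normB _ _) (lerD h h2).
by field; rewrite !gt_eqF.
Qed.

Lemma lim_time_err t : (t <= L)%N ->
  `|z t - t%:R / T%:R| <= ((2 * C + b) / b + 1) / g%:R.
Proof.
have [->|t0 tL] := posnP t.
  rewrite lim_time0// mul0r subr0 normr0 divr_ge0 ?addr_ge0// divr_ge0 ?ltW//.
  by rewrite addr_gt0// mulr_gt0.
have tLg := tL; rewrite preLambdaE// in tLg.
have tT : (t <= T)%N := leq_trans tLg (leq_subr _ _).
have TR : 0 < T%:R :> R by rewrite ltr0n (leq_trans t0).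
have nR : 0 < (T.+1 - t)%N%:R :> R by rewrite ltr0n subn_gt0.
have h1 : `|(1 - z t) - (T.+1 - t)%N%:R / T.+1%:R| <= (2 * C + b) / b / g%:R.
  rewrite -{1}(lnK (_ : 1 - z t \is Num.pos)) ?posrE ?onem_lim_time//.
  rewrite -(lnK (_ : (T.+1 - t)%N%:R / T.+1%:R \is Num.pos)) ?posrE ?divr_gt0//.
  apply: le_trans (expR_lip _ _) _.
  - apply: ln_le0; rewrite lerBlDr lerDl.
    by have /andP[] := lim_time_itv U_gt0 b_gt0 mu_gt0 mu_ltU gT tL.
  - by apply: ln_le0; rewrite ler_pdivrMr// mul1r ler_nat leq_subr.
  by rewrite ln_div ?posrE// ln_onem_lim_time_err// t0.
have h2 : `|t%:R / T%:R - t%:R / T.+1%:R : R| <= g%:R^-1.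
  rewrite (_ : _ - _ = t%:R / T%:R / T.+1%:R); last first.
    by rewrite -natr1; field; rewrite !gt_eqF//= ltr_wpDl// ltW.
  rewrite ger0_norm ?divr_ge0//.
  apply: (@le_trans _ _ (T.+1%:R^-1)).
    by rewrite ler_piMl ?invr_ge0// ler_pdivrMr// mul1r ler_nat.
  by rewrite lef_pV2 ?posrE// ler_nat ltnW// ltnS ltnW.
rewrite [leRHS]mulrDl mul1r.
apply: le_trans _ (lerD h1 h2); rewrite -normrN; apply: le_trans _ (ler_normD _ _).
rewrite le_eqVlt; apply/orP; left; apply/eqP; congr (`|_|).
rewrite (natrB _ (leqW tT)).
by rewrite -natr1; field; rewrite !gt_eqF//= ltr_wpDl// ltW.
Qed.

(** [preX t] and [limitX (lim_time t)] are both proportional to [preD t]; the two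
coefficients are at most [1], so their distance is bounded by that of their
logarithms. *)
Lemma preX_err t : (0 < t <= L)%N ->
  `|preX U b mu T t - limitX U b mu (z t)| <= U * (C / b + 1 + b) / g%:R.
Proof.
move=> /[dup] tL /andP[t0 tL'].
have [z0 zL] := andP (lim_time_itv U_gt0 b_gt0 mu_gt0 mu_ltU gT tL').
have z1 := onem_lim_time U_gt0 b_gt0 mu_gt0 mu_ltU gT tL'.
rewrite preXE//.
have -> : limitX U b mu (z t) =
    (limGamma U mu `^ b^-1 / (1 - z t)) * preD U b mu T t.
  have <- := limD_lim_time U_gt0 b_gt0 mu_gt0 mu_ltU gT tL'.
  move: (z t) z1 => a a1.
  rewrite /limitX /limitD (opprD b). rewrite powRD; last by rewrite (gt_eqF a1) implybT.
  by rewrite powR_inv1 ?ltW//; ring.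
have Dle := preD_leU U_gt0 b_gt0 mu_gt0 mu_ltU gT tL'.
have D0 := preD_gt0 U_gt0 b_gt0 mu_gt0 mu_ltU gT tL'.
rewrite -mulrBl normrM (gtr0_norm D0) mulrC -mulrA.
apply: ler_pM => //; first exact: ltW.
set N := (T.+1 - t)%N.
have gN : (g < N)%N := Gamma_lt_sub gT tL'.
have NR : 0 < N%:R :> R by rewrite ltr0n (leq_trans _ gN).
have bN : 0 < b + N%:R by rewrite addr_gt0.
have gG : 0 < limGamma U mu `^ b^-1 by rewrite powR_gt0.
rewrite -(lnK (_ : g%:R / (b + N%:R) \is Num.pos)) ?posrE ?divr_gt0//.
rewrite -(lnK (_ : limGamma U mu `^ b^-1 / (1 - z t) \is Num.pos)) ?posrE ?divr_gt0//.
apply: le_trans (expR_lip _ _) _.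
- apply: ln_le0; rewrite ler_pdivrMr// mul1r ler_wpDl ?ltW//.
  by rewrite ltr_nat.
- apply: ln_le0; rewrite ler_pdivrMr// mul1r; move: zL; rewrite /limLambda; lra.
rewrite !ln_div ?posrE//.
have -> : ln (limGamma U mu `^ b^-1) - ln (1 - z t) = b^-1 * ln (ratio_prod b g.+1 N).
  rewrite /lim_time subKr !ln_powR -mulrBr; congr (_ * _).
  rewrite -ln_div ?posrE//; last by rewrite divr_gt0.
  by congr ln; rewrite preDE// -/N /limGamma; field; rewrite !gt_eqF// ratio_prod_gt0.
have := @ratio_prod_weak _ b g.+1 N b_gt0 isT gN.
move=> /le_trans /(_ (ler_wpM2l (ltW C_gt0) gV)) h2.
have h3 := lnS_err g_gt0.
have h4 : `|ln (b + N%:R) - ln N%:R| <= b / g%:R.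
  apply: le_trans (ln_lip NR _ _) _ => //; first by rewrite lerDr ltW.
  rewrite addrK gtr0_norm// ler_pM2l// lef_pV2 ?posrE//.
  by rewrite ler_nat ltnW.
rewrite [leRHS](_ : _ = C / g%:R / b + g%:R^-1 + b / g%:R); last by ring.
have h5 : `|b^-1 * (ln (ratio_prod b g.+1 N) + b * (ln N%:R - ln g.+1%:R))| <= C / g%:R / b.
  by rewrite normrM (gtr0_norm (_ : 0 < b^-1)) ?invr_gt0// mulrC ler_pM2r ?invr_gt0.
apply: le_trans _ (lerD (lerD h5 h3) h4).
rewrite -normrN; apply: le_trans _ (lerD (ler_normD _ _) (lexx _)).
apply: le_trans _ (ler_normD _ _).
rewrite le_eqVlt; apply/orP; left; apply/eqP; congr (`|_|).
by field; rewrite !gt_eqF.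
Qed.

End fixed_horizon.

(** [preGamma U b mu T = T] would force [U * (T / (b + T)) < mu], which fails for
large [T] because [mu < U]. *)
Lemma preGamma_lt_near : \forall n \near \oo, (preGamma U b mu n < n)%N.
Proof.
near=> T.
have muU : 0 < mu < U by rewrite mu_gt0.
have [gT gmu] := preGammaP b T muU.
rewrite ltn_neqAle gT andbT; apply/eqP => gE.
have T0 : (0 < T)%N by near: T; exists 1%N.
have := @Gamma_lt_mu R U b mu mu_gt0 mu_ltU T; rewrite gE => /(_ T0).
rewrite ratio_prodSr// /ratio_prod big_geq// mul1r.
have TR : 0 < T%:R :> R by rewrite ltr0n.
rewrite mulrA ltr_pdivrMr ?addr_gt0//; apply/negP; rewrite -leNgt.
have : b * mu / (U - mu) <= T%:R by near: T; exact: nbhs_infty_ger.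
by rewrite ler_pdivrMr ?subr_gt0//; lra.
Unshelve. all: by end_near. Qed.

(** The error in [ln_ratio_prod] is bounded even for small indices, so
[preGamma] grows at least like a constant times [T]. *)
Lemma preGamma_cvgy : ((preGamma U b mu n)%:R : R) @[n --> \oo] --> +oo%R.
Proof.
apply/cvgryPge => A; near=> T.
have gT : (preGamma U b mu T < T)%N by near: T; exact: preGamma_lt_near.
set g := preGamma U b mu T in gT *.
have := @ratio_prod_weak _ b g.+1 T.+1 b_gt0 isT (ltnW gT).
rewrite ler_norml => /andP[_ h].
have up : ln (mu / U) <= ln (ratio_prod b g.+1 T.+1).
  rewrite ler_ln ?posrE ?ratio_prod_gt0 ?divr_gt0// ler_pdivrMr// mulrC.
  exact: mu_le_Gamma.
have hC : C / g.+1%:R <= C.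
  by rewrite ler_piMr ?(ltW C_gt0)// invf_le1 ?ltr0n// ler1n.
have h2 : ln T.+1%:R + (ln (mu / U) - C) / b <= ln g.+1%:R.
  rewrite -(ler_pM2l b_gt0) mulrDr [b * (_ / b)]mulrC divfK ?gt_eqF//.
  move: (le_trans h hC) up; rewrite mulrBr.
  move: (ln _) (ln _) (_ * ln _) (_ * ln _) C => x1 x2 x3 x4 c; lra.
have h3 : T.+1%:R * expR ((ln (mu / U) - C) / b) <= g.+1%:R.
  by rewrite -ler_ln ?posrE ?mulr_gt0 ?expR_gt0// lnM ?posrE ?expR_gt0// expRK.
have : (A + 1) / expR ((ln (mu / U) - C) / b) <= T%:R.
  by near: T; exact: nbhs_infty_ger.
rewrite ler_pdivrMr ?expR_gt0// => h4.
have h5 : A + 1 <= g.+1%:R.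
  apply: le_trans h4 (le_trans _ h3).
  by rewrite ler_pM2r ?expR_gt0// ler_nat.
by rewrite -natr1 lerD2r in h5.
Unshelve. all: by end_near. Qed.

Lemma prelimit_near (e : R) : 0 < e -> \forall n \near \oo,
  [/\ (0 < preGamma U b mu n)%N, (preGamma U b mu n < n)%N,
    n%:R^-1 <= e,
    forall t, (t <= preLambda U b mu n)%N ->
      `|lim_time U b mu n t - t%:R / n%:R| <= e &
    forall t, (0 < t <= preLambda U b mu n)%N ->
      `|preX U b mu n t - limitX U b mu (lim_time U b mu n t)| <= e].
Proof.
move=> e0.
pose K := ((2 * C + b) / b + 1) + U * (C / b + 1 + b) + 1.
have p1 : 0 < (2 * C + b) / b by rewrite divr_gt0// addr_gt0// mulr_gt0.
have p2 : 0 < U * (C / b + 1 + b).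
  by rewrite mulr_gt0// !addr_gt0// mulr_gt0// invr_gt0.
have K0 : 0 < K by rewrite /K; lra.
near=> T.
have gK : K / e <= (preGamma U b mu T)%:R.
  by near: T; have /cvgryPge := preGamma_cvgy; exact.
have gT : (preGamma U b mu T < T)%N by near: T; exact: preGamma_lt_near.
have gR : 0 < (preGamma U b mu T)%:R :> R by apply: lt_le_trans gK; exact: divr_gt0.
have Kg : K / (preGamma U b mu T)%:R <= e by rewrite ler_pdivrMr// mulrC -ler_pdivrMr.
have g0 : (0 < preGamma U b mu T)%N by rewrite -(ltr0n R).
have gV : 0 <= (preGamma U b mu T)%:R^-1 :> R by rewrite invr_ge0 ltW.
split => //.
- have TR : 0 < T%:R :> R by apply: lt_trans gR _; rewrite ltr_nat.
  apply: le_trans _ Kg; apply: (@le_trans _ _ (preGamma U b mu T)%:R^-1).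
    by rewrite lef_pV2 ?posrE// ler_nat ltnW.
  by rewrite ler_peMl// /K; lra.
- move=> t tL; apply: le_trans (lim_time_err _ _ _) _ => //.
  by apply: le_trans _ Kg; rewrite ler_wpM2r// /K; lra.
- move=> t tL; apply: le_trans (preX_err _ _ _) _ => //.
  by apply: le_trans _ Kg; rewrite ler_wpM2r// /K; lra.
Unshelve. all: by end_near. Qed.

End asymptotics.

(** * Time changes and J1 distance *)

Section J1_closeness.
Context {R : realType}.

(** Factoring out [c `^ (- q)] leaves exponentials of nonpositive arguments, which
are [1]-Lipschitz. *)
Lemma powRN_lip (c q x y : R) : 0 < c -> 0 <= q -> c <= x -> c <= y ->
  `|x `^ (- q) - y `^ (- q)| <= c `^ (- q) * (q / c) * `|x - y|.
Proof.
move=> c0 q0 cx cy; have x0 := lt_le_trans c0 cx; have y0 := lt_le_trans c0 cy.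
have E w : c <= w -> w `^ (- q) = c `^ (- q) * expR (- q * (ln w - ln c)).
  move=> cw; have w0 := lt_le_trans c0 cw.
  rewrite /powR !gt_eqF// -expRD; congr expR; ring.
rewrite (E _ cx) (E _ cy) -mulrBr normrM (ger0_norm (powR_ge0 _ _)) -mulrA ler_wpM2l ?powR_ge0//.
apply: le_trans (expR_lip _ _) _.
- by rewrite mulNr oppr_le0 mulr_ge0// subr_ge0 ler_ln ?posrE.
- by rewrite mulNr oppr_le0 mulr_ge0// subr_ge0 ler_ln ?posrE.
rewrite -mulrBr normrM normrN (ger0_norm q0) -mulrA ler_wpM2l//.
rewrite opprB addrA subrK mulrC; exact: ln_lip.
Qed.

Lemma prod_norm_le {V W : normedModType R} (x : V * W) (r : R) :
  (`|x| <= r) = (`|x.1| <= r) && (`|x.2| <= r).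
Proof. by rewrite prod_normE ge_max. Qed.

(** The piecewise linear bijection of [[0, 1]] carrying [s] to [z]. *)
Definition move_jump (s z t : R) : R :=
  if t <= s then t * (z / s) else 1 - (1 - t) * ((1 - z) / (1 - s)).

Section move_jump.
Variables s z : R.
Hypotheses (s01 : 0 < s < 1) (z01 : 0 < z < 1).

Let s0 : 0 < s. Proof. by case/andP: s01. Qed.
Let s1 : 0 < 1 - s. Proof. by case/andP: s01; rewrite subr_gt0. Qed.
Let z0 : 0 < z. Proof. by case/andP: z01. Qed.
Let z1 : 0 < 1 - z. Proof. by case/andP: z01; rewrite subr_gt0. Qed.
Let a0 : 0 < z / s. Proof. exact: divr_gt0. Qed.
Let c0 : 0 < (1 - z) / (1 - s). Proof. exact: divr_gt0. Qed.

Lemma move_jump_lt t : (move_jump s z t < z) = (t < s).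
Proof.
rewrite /move_jump; case: (leP t s) => ts.
  by rewrite mulrCA -ltr_pdivlMl// mulVf ?gt_eqF// ltr_pdivrMr// mul1r.
rewrite [RHS]ltNge (ltW ts)/=; apply/negbTE; rewrite -leNgt mulrCA.
have w1 : (1 - t) / (1 - s) <= 1 by rewrite ler_pdivrMr//; lra.
have := ler_wpM2l (ltW z1) w1; rewrite mulr1; lra.
Qed.

Lemma move_jump_close t : t \in `[0, 1] -> `|move_jump s z t - t| <= `|z - s|.
Proof.
rewrite in_itv/= => /andP[t0 t1]; rewrite /move_jump; case: (leP t s) => ts.
  rewrite (_ : _ - _ = (z - s) * (t / s)); last by field; rewrite gt_eqF.
  rewrite normrM ler_piMr// ger0_norm ?divr_ge0 ?(ltW s0)//.
  by rewrite ler_pdivrMr// mul1r.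
rewrite (_ : _ - _ = (z - s) * ((1 - t) / (1 - s))); last by field; rewrite gt_eqF.
rewrite normrM ler_piMr// ger0_norm ?divr_ge0 ?(ltW s1) ?subr_ge0//.
by rewrite ler_pdivrMr// mul1r lerB// ltW.
Qed.

Lemma move_jump_time_change : time_change (move_jump s z).
Proof.
have incr : {homo move_jump s z : x y / x < y}.
  move=> x y xy; have := move_jump_lt x; have := move_jump_lt y.
  rewrite /move_jump; case: (leP x s) => xs; case: (leP y s) => ys.
  - by move=> _ _; rewrite ltr_pM2r.
  - move=> _ _; apply: (@le_lt_trans _ _ z).
      by rewrite mulrCA ger_pMr// ler_pdivrMr// mul1r.
    rewrite -subr_gt0 (_ : _ - _ = (1 - z) * (1 - (1 - y) / (1 - s))); last by ring.
    by rewrite mulr_gt0// subr_gt0 ltr_pdivrMr// mul1r; lra.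
  - by lra.
  - by move=> _ _; rewrite ltrD2l ltrN2 ltr_pM2r//; lra.
have e0 : move_jump s z 0 = 0 by rewrite /move_jump (ltW s0) mul0r.
have e1 : move_jump s z 1 = 1.
  by rewrite /move_jump leNgt -subr_gt0 s1/= subrr mul0r subr0.
apply: incr_onto_time_change; first by move=> x y _ _; exact: incr.
have leh : {mono move_jump s z : x y / x <= y} := le_mono incr.
apply/seteqP; split => [_ [t t01 <-]|t]; rewrite /= !in_itv/=.
  by move: t01; rewrite /= in_itv/= -[in X in _ -> X]e0 -[in X in _ -> X]e1 !leh.
move=> /andP[t0 t1]; have [tz|zt] := leP t z.
  exists (t * (s / z)); last first.
    rewrite /move_jump mulrCA ger_pMr// ler_pdivrMr// mul1r tz.
    by field; rewrite !gt_eqF.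
  rewrite /= in_itv/= mulr_ge0 ?divr_ge0 ?(ltW s0) ?(ltW z0)//=.
  rewrite mulrCA; apply: (mulr_ile1 (ltW s0)); last first.
  - by rewrite ler_pdivrMr// mul1r.
  - by case/andP: s01 => _ /ltW.
  - by rewrite divr_ge0// ltW.
exists (1 - (1 - t) * ((1 - s) / (1 - z))); last first.
  rewrite /move_jump ifF; first by field; rewrite !gt_eqF.
  apply/negbTE; rewrite -ltNge -subr_gt0.
  rewrite (_ : _ - _ = (1 - s) * (1 - (1 - t) / (1 - z))); last by ring.
  by rewrite mulr_gt0// subr_gt0 ltr_pdivrMr// mul1r; lra.
rewrite /= in_itv/=; have : (1 - t) * ((1 - s) / (1 - z)) <= 1.
  rewrite mulrCA; apply: (mulr_ile1 (ltW s1)); last first.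
  - by rewrite ler_pdivrMr// mul1r; lra.
  - by rewrite lerBlDr lerDl ltW.
  - by rewrite divr_ge0 ?(ltW z1)// subr_ge0.
have : 0 <= (1 - t) * ((1 - s) / (1 - z)).
  by rewrite mulr_ge0 ?divr_ge0 ?(ltW s1) ?(ltW z1)// subr_ge0.
by move=> *; apply/andP; split; lra.
Qed.

End move_jump.

Lemma J1_ball_move_jump {V : normedModType R} (x y : skorokhod V) (s z r e : R) :
  0 < s < 1 -> 0 < z < 1 -> r < e -> `|z - s| <= r ->
  (forall t, t \in `[0, 1] -> `|x t - y (move_jump s z t)| <= r) ->
  J1_ball x e y.
Proof.
move=> s01 z01 re zs xy; exists (move_jump s z).
  exact: move_jump_time_change.
exists r => // t t01; split; last exact: xy.
exact: le_trans (move_jump_close z s01 t01) zs.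
Qed.

Lemma time_change_id : time_change (id : R -> R).
Proof. by apply: incr_onto_time_change; [by []|rewrite image_id]. Qed.

Section paths.
Variables (U b mu : R).
Hypotheses (U_gt0 : 0 < U) (b_gt0 : 0 < b) (mu_gt0 : 0 < mu) (mu_ltU : mu < U).
Notation Lam := (limLambda U b mu).

Let limLam1 : 0 < 1 - Lam.
Proof. by rewrite subr_gt0 limLambda_lt1. Qed.

Lemma limX_lip : exists2 K : R, 0 < K & forall a c : R, a <= Lam -> c <= Lam ->
  `|limitX U b mu a - limitX U b mu c| <= K * `|a - c| /\
  `|limitD b mu a - limitD b mu c| <= K * `|a - c|.
Proof.
have [K K_gt0 lip] : exists2 K : R -> R, (forall q, 0 < q -> 0 < K q) &
    forall q a c, 0 < q -> a <= Lam -> c <= Lam ->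
    `|(1 - a) `^ (- q) - (1 - c) `^ (- q)| <= K q * `|a - c|.
  exists (fun q => (1 - Lam) `^ (- q) * (q / (1 - Lam))).
    by move=> q q0; rewrite mulr_gt0 ?divr_gt0// powR_gt0.
  move=> q a c q0 aL cL.
  have := @powRN_lip (1 - Lam) q (1 - a) (1 - c) limLam1 (ltW q0).
  rewrite !lerD2l !lerN2 => /(_ aL cL).
  by rewrite (_ : 1 - a - (1 - c) = c - a) ?(distrC c)//; ring.
have m0 : 0 < mu * limGamma U mu `^ b^-1.
  by rewrite mulr_gt0// powR_gt0// divr_gt0.
have bp : 0 < b + 1 by rewrite addr_gt0.
exists (mu * limGamma U mu `^ b^-1 * K (b + 1) + mu * K b).
  by rewrite addr_gt0// mulr_gt0// K_gt0.
move=> a c aL cL; rewrite /limitX /limitD -!mulrBr.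
rewrite normrM (gtr0_norm m0) normrM (gtr0_norm mu_gt0) mulrDl.
have h q x : 0 < q -> 0 < x -> 0 <= x * K q * `|a - c|.
  by move=> q0 x0; rewrite mulr_ge0// mulr_ge0// ltW// K_gt0.
split.
- apply: le_trans (_ : _ <= mu * limGamma U mu `^ b^-1 * (K (b + 1) * `|a - c|)) _.
    by rewrite ler_pM2l// lip.
  by rewrite [leLHS]mulrA lerDl h.
- apply: le_trans (_ : _ <= mu * (K b * `|a - c|)) _.
    by rewrite ler_pM2l// lip.
  by rewrite [leLHS]mulrA lerDr h.
Qed.

Lemma lim_pathE (z : R) (z0L : 0 <= z <= Lam) (t : R) : t \in `[0, 1] ->
  lim_path U_gt0 mu_gt0 z0L t = lim_fun U b mu z t.
Proof. by move=> t01; rewrite /= /restr01 t01. Qed.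

(** Continuity holds only at interior jump times: near [0] the jump can be moved
to time [0] by no time change, and at [limLambda] there is no jump. *)
Lemma lim_path_near (z : R) (z0L : 0 <= z <= Lam) (e : R) : 0 < z < Lam -> 0 < e ->
  \forall z' \near z, forall (z0L' : 0 <= z' <= Lam),
    J1_ball (lim_path U_gt0 mu_gt0 z0L) e (lim_path U_gt0 mu_gt0 z0L').
Proof.
move=> /andP[z0 zL] e0; have [K K0 lip] := limX_lip.
have L1 : Lam < 1 by rewrite -subr_gt0.
near=> z' => z0L'.
have z'0 : 0 < z' by near: z'; exact: lt_nbhsr.
have z'L : z' < Lam by near: z'; exact: lt_nbhsl.
have z'z : `|z' - z| <= e / (K + 1) / 2.
  near: z'; rewrite /prop_near1/=; apply/nbhs_ballP.
  exists (e / (K + 1) / 2); first by rewrite /= !divr_gt0// addr_gt0.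
  by move=> w /=; rewrite /ball/= distrC => /ltW.
have z01 : 0 < z < 1 by rewrite z0 (lt_trans zL).
have z'01 : 0 < z' < 1 by rewrite z'0 (lt_trans z'L).
pose d := e / (K + 1) / 2.
have d0 : 0 < d by rewrite !divr_gt0// addr_gt0.
have dE : (K + 1) * d < e.
  rewrite (_ : _ * d = e / 2); first by lra.
  by rewrite /d; field; rewrite gt_eqF// addr_gt0.
apply: (@J1_ball_move_jump _ _ _ z z' ((K + 1) * d)) => //.
  by apply: le_trans z'z _; rewrite ler_peMl ?(ltW d0)// lerDr ltW.
move=> t t01; rewrite !lim_pathE//; last exact: time_change_mem (move_jump_time_change _ _) _.
have K1 w : w <= d -> K * w <= (K + 1) * d.
  move=> wd; apply: le_trans (_ : K * d <= _); first by rewrite ler_pM2l.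
  by rewrite ler_pM2r// lerDl.
rewrite /lim_fun move_jump_lt// zL z'L; case: ifPn => tz; rewrite prod_norm_le/=.
  have mz : move_jump z z' t <= Lam.
    by rewrite ltW// (lt_trans _ z'L)// move_jump_lt.
  have tm : `|t - move_jump z z' t| <= d.
    by rewrite distrC (le_trans (move_jump_close _ _ _))// (le_trans _ z'z).
  have [h1 h2] := lip _ _ (ltW (lt_trans tz zL)) mz.
  by rewrite (le_trans h1 (K1 _ tm)) (le_trans h2 (K1 _ tm)).
rewrite subrr normr0; have [h1 _] := lip _ _ (ltW zL) (ltW z'L).
rewrite (le_trans h1) ?K1// 1?distrC//=.
by rewrite mulr_ge0 ?ltW// addr_gt0.
Unshelve. all: by end_near. Qed.

End paths.
End J1_closeness.

(** * The possible trajectories of the chain *)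

Section scenarios.
Context {R : realType}.

Lemma min_close (e a b c d : R) : `|a - b| <= e -> `|c - d| <= e ->
  `|Num.min a c - Num.min b d| <= e.
Proof.
rewrite !ler_norml => /andP[? ?] /andP[? ?].
by case: (leP a c) => ?; case: (leP b d) => ?; apply/andP; split; lra.
Qed.

Variables (U b mu : R).

Definition alive_path (T t : nat) : R * R :=
  if (t <= preLambda U b mu T)%N then (preX U b mu T t, preD U b mu T t)
  else (U, U).

(** For [1 <= k <= preLambda] the second coordinate jumps to zero at step [k]; for
[k] larger than [preLambda] there is no jump. *)
Definition scenario (T k t : nat) : R * R :=
  if (k <= t)%N && (k <= preLambda U b mu T)%N then (preX U b mu T k, 0)
  else alive_path T t.

Hypotheses (U_gt0 : 0 < U) (b_gt0 : 0 < b) (mu_gt0 : 0 < mu) (mu_ltU : mu < U).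
Notation Lam := (limLambda U b mu).

Lemma pre_pathE (T : nat) (m : nat -> R * R) (t : R) : t \in `[0, 1] ->
  pre_path T m t = pre_fun T m t.
Proof. by move=> t01; rewrite /= /restr01 t01. Qed.

Lemma limX_limLambda : limitX U b mu Lam = U.
Proof.
have G0 : 0 < limGamma U mu by rewrite divr_gt0.
rewrite /limitX /limLambda subKr -powRrM mulrN mulrDr mulVf ?gt_eqF// mulr1.
rewrite opprD powRD ?(gt_eqF G0) ?implybT//.
rewrite powR_inv1 ?(ltW G0)// powRN.
have : 0 < limGamma U mu `^ b^-1 by rewrite powR_gt0.
move: (_ `^ _) => p p0; rewrite /limGamma.
by field; rewrite !gt_eqF.
Qed.

Lemma limD_limLambda : limitD b mu Lam = U.
Proof.
have G0 : 0 < limGamma U mu by rewrite divr_gt0.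
rewrite /limitD /limLambda subKr -powRrM mulrN mulVf ?gt_eqF//.
by rewrite powR_inv1 ?(ltW G0)// /limGamma; field; rewrite !gt_eqF.
Qed.

Section fixed_horizon.
Variables (T : nat) (e : R).
Notation g := (preGamma U b mu T).
Notation L := (preLambda U b mu T).
Notation z_ := (lim_time U b mu T).
Hypotheses (g_gt0 : (0 < g)%N) (gT : (g < T)%N) (Te : T%:R^-1 <= e).
Hypothesis z_err : forall t, (t <= L)%N -> `|z_ t - t%:R / T%:R| <= e.
Hypothesis X_err : forall t, (0 < t <= L)%N ->
  `|preX U b mu T t - limitX U b mu (z_ t)| <= e.
Variable K : R.
Hypotheses (K0 : 0 < K)
 (lip : forall a c : R, a <= Lam -> c <= Lam ->
  `|limitX U b mu a - limitX U b mu c| <= K * `|a - c| /\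
  `|limitD b mu a - limitD b mu c| <= K * `|a - c|).

Let T0 : 0 < T%:R :> R. Proof. by rewrite ltr0n (leq_ltn_trans _ gT). Qed.
Let e0 : 0 <= e. Proof. by rewrite (le_trans _ Te)// invr_ge0 ltW. Qed.
Let LT : (L < T)%N.
Proof. by rewrite preLambdaE// ltn_subrL g_gt0 (leq_ltn_trans _ gT). Qed.

Let step (t : R) : nat := maxn (Num.truncn (t * T%:R)) 1.

Let step_gt0 t : (0 < step t)%N. Proof. by rewrite leq_max orbT. Qed.

Let step_close (t : R) : 0 <= t -> `|t - (step t)%:R / T%:R| <= e.
Proof.
move=> t0; apply: le_trans Te.
have tT0 : 0 <= t * T%:R by rewrite mulr_ge0// ltW.
have /andP[h1 h2] := truncn_itv tT0.
have -> : t - (step t)%:R / T%:R = (t * T%:R - (step t)%:R) / T%:R.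
  by field; rewrite gt_eqF.
rewrite normrM (gtr0_norm (_ : 0 < T%:R^-1)) ?invr_gt0//.
rewrite ler_piMl ?invr_ge0 ?(ltW T0)// /step.
case: (Num.truncn _) h1 h2 => [|n] h1 h2.
  by rewrite max0n ler_norml; apply/andP; split; lra.
rewrite (maxn_idPl _)//; move: h1 h2; rewrite -[n.+2%:R]natr1.
by move: (n.+1%:R) => n1 h1 h2; rewrite ler_norml; apply/andP; split; lra.
Qed.

(** The error on both coordinates reduces to the distance of [a] to
[lim_time t]. *)
Lemma lim_err (a : R) t : (0 < t <= L)%N -> a <= Lam ->
  `|preX U b mu T t - limitX U b mu a| <= e + K * `|z_ t - a| /\
  `|preD U b mu T t - limitD b mu a| <= e + K * `|z_ t - a|.
Proof.
move=> tL aL; have /andP[t0 tL'] := tL.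
have /andP[_ zL] := lim_time_itv U_gt0 b_gt0 mu_gt0 mu_ltU gT tL'.
have [h1 h2] := lip zL aL; split.
  rewrite -(subrKA (limitX U b mu (z_ t))).
  by apply: le_trans (ler_normD _ _) (lerD _ h1); exact: X_err.
by rewrite -(limD_lim_time U_gt0 b_gt0 mu_gt0 mu_ltU gT tL') (le_trans h2)// lerDr.
Qed.

(** Before the jump the compared times differ by at most four errors of size [e]:
two from the time change, one from rounding [t * T] and one from [lim_time];
after the jump both paths are constant.  The bound [2 * e < z] excludes [k = 1],
for which the pre-limit path has no value before the jump. *)
Lemma J1_ball_killed (z : R) (z0L : 0 <= z <= Lam) k (r : R) : 2 * e < z -> z < Lam ->
  (0 < k <= L)%N -> z_ k.-1 <= z < z_ k -> (4 * K + 2) * e < r ->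
  J1_ball (pre_path T (scenario T k)) r (lim_path U_gt0 mu_gt0 z0L).
Proof.
move=> ez zL /[dup] kL /andP[k0 kL'] /andP[zk1 zk2] er.
have z0 : 0 < z by apply: le_lt_trans ez; rewrite mulr_ge0.
have kT : (k < T)%N := leq_ltn_trans kL' LT.
have [s sdef] : exists s : R, s = k%:R / T%:R by eexists.
have := z_err kL'; rewrite -sdef ler_norml => /andP[hk1 hk2].
have kpL : (k.-1 <= L)%N := leq_trans (leq_pred k) kL'.
have := z_err kpL; rewrite ler_norml => /andP[hk3 hk4].
have k1s : k.-1%:R / T%:R = s - T%:R^-1.
  by rewrite sdef -[in k%:R](prednK k0) -natr1 mulrDl mul1r addrK.
rewrite k1s in hk3 hk4.
have k2 : (1 < k)%N.
  rewrite ltn_neqAle k0 andbT; apply/eqP => k1.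
  have se : s <= e by rewrite sdef -k1 mul1r.
  suff : z < 2 * e by rewrite ltNge (ltW ez).
  lra.
have s01 : 0 < s < 1.
  rewrite sdef; apply/andP; split; first by rewrite divr_gt0// ltr0n.
  by rewrite ltr_pdivrMr// mul1r ltr_nat.
have z01 : 0 < z < 1 by rewrite z0 (lt_trans zL)// limLambda_lt1.
have zs : `|z - s| <= 2 * e.
  move: hk3 hk4 Te; move: T%:R^-1 => i hk3 hk4 ie.
  by rewrite ler_norml; apply/andP; split; lra.
have Ke : 0 <= K * e by rewrite mulr_ge0// ltW.
apply: (J1_ball_move_jump s01 z01 er).
  by apply: le_trans zs _; lra.
move=> t t01; rewrite pre_pathE// lim_pathE; last first.
  exact: time_change_mem (move_jump_time_change _ _) _.
have t0 : 0 <= t by move: t01; rewrite in_itv/= => /andP[].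
have hs := step_close t0.
have tcL := move_jump_close z s01 t01.
rewrite /lim_fun move_jump_lt// zL /pre_fun -/(step t) /scenario kL' andbT.
have -> : (k <= step t)%N = ~~ (t < s).
  rewrite -leNgt sdef ler_pdivrMr// /step leq_max [(k <= 1)%N]leqNgt k2 orbF.
  by rewrite truncn_ge_nat// mulr_ge0// ltW.
case: ltP => ts /=.
  have sk : (step t < k)%N.
    rewrite /step gtn_max k2 andbT.
    by rewrite truncn_lt_nat ?mulr_ge0 ?(ltW T0)// -ltr_pdivlMr// -sdef.
  have sL : (step t <= L)%N by rewrite (leq_trans (ltnW sk)).
  have aL : move_jump s z t <= Lam by rewrite ltW// (lt_trans _ zL)// move_jump_lt.
  have zsL := z_err sL.
  have za : `|z_ (step t) - move_jump s z t| <= 4 * e.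
    move: zsL hs (le_trans tcL zs); rewrite !ler_norml.
    by move=> /andP[? ?] /andP[? ?] /andP[? ?]; apply/andP; split; lra.
  have zaK : K * `|z_ (step t) - move_jump s z t| <= K * (4 * e) by rewrite ler_pM2l.
  have stL : (0 < step t <= L)%N by rewrite step_gt0.
  have [h1 h2] := lim_err stL aL.
  rewrite /alive_path sL prod_norm_le/=.
  by apply/andP; split; lra.
rewrite prod_norm_le/= subrr normr0.
have [h1 _] := lim_err kL (ltW zL).
have : `|z_ k - z| <= 3 * e.
  move: zs; rewrite !ler_norml => /andP[? ?].
  by apply/andP; split; lra.
rewrite -(ler_pM2l K0) => h2.
by apply/andP; split; lra.
Qed.

(** The limit path at [t] is the pair of [limitX] and [limitD] at
[Num.min t Lam], as both functions reach the value [U] at [limLambda]; truncating the step at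
[preLambda] is the analogous description of the pre-limit path. *)
Lemma J1_ball_alive (z0L : 0 <= Lam <= Lam) k (r : R) : (L < k)%N ->
  (4 * K + 2) * e < r ->
  J1_ball (pre_path T (scenario T k)) r (lim_path U_gt0 mu_gt0 z0L).
Proof.
move=> kL er; exists id; first exact: time_change_id.
have Ke : 0 <= K * e by rewrite mulr_ge0// ltW.
have r0 : 0 <= (4 * K + 2) * e by rewrite mulr_ge0// addr_ge0// mulr_ge0// ltW.
suff H (t : R) : t \in `[0, 1] ->
    `|pre_path T (scenario T k) t - lim_path U_gt0 mu_gt0 z0L t| <= (4 * K + 2) * e.
  by exists ((4 * K + 2) * e) => // t t01; rewrite subrr normr0; split; [|exact: H].
move=> t01; rewrite pre_pathE// lim_pathE//.
have t0 : 0 <= t by move: t01; rewrite in_itv/= => /andP[].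
have hs := step_close t0.
have L0 : (0 < L)%N := preLambda_gt0 gT.
have := z_err (leqnn L); rewrite lim_time_Lambda// => hL.
pose j := minn (step t) L.
have jL : (0 < j <= L)%N by rewrite leq_min step_gt0 L0 geq_minr.
have zj : `|z_ j - Num.min t Lam| <= 2 * e.
  have jE : j%:R / T%:R = Num.min ((step t)%:R / T%:R) (L%:R / T%:R) :> R.
    rewrite /j; case: (leqP (step t) L) => h.
      by rewrite min_l// ler_pM2r ?invr_gt0// ler_nat.
    by rewrite min_r// ler_pM2r ?invr_gt0// ler_nat ltnW.
  have /andP[_ jL'] := jL; have h1 := z_err jL'.
  have h2 : `|j%:R / T%:R - Num.min t Lam| <= e.
    by rewrite jE min_close 1?distrC// distrC.
  rewrite (_ : 2 * e = e + e); last by ring.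
  rewrite -(subrKA (j%:R / T%:R)).
  exact: le_trans (ler_normD _ _) (lerD h1 h2).
have KzJ : K * `|z_ j - Num.min t Lam| <= K * (2 * e) by rewrite ler_pM2l.
have mL : Num.min t Lam <= Lam by rewrite ge_min lexx orbT.
have e0R : (0 : R) <= e := e0.
have bnd x : x <= e + K * `|z_ j - Num.min t Lam| -> x <= (4 * K + 2) * e by lra.
have [/bnd h1 /bnd h2] := lim_err jL mL.
have -> : lim_fun U b mu Lam t = (limitX U b mu (Num.min t Lam), limitD b mu (Num.min t Lam)).
  rewrite /lim_fun ltxx; case: (ltP t Lam) => // _.
  by rewrite limX_limLambda limD_limLambda.
rewrite /pre_fun -/(step t) /scenario (leqNgt k L) kL andbF /alive_path.
have /andP[_ zjL] : 0 <= z_ j <= Lam.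
  by apply: lim_time_itv => //; case/andP: jL.
have [] := lip zjL mL.
move: bnd h1 h2; rewrite /j.
case: leqP => h bnd; rewrite prod_norm_le/=; first by move=> -> ->.
rewrite lim_time_Lambda// limX_limLambda limD_limLambda => _ _ l1 l2.
by rewrite !bnd// (le_trans l1, le_trans l2) // lim_time_Lambda// lerDr.
Qed.

End fixed_horizon.

End scenarios.

(** * Expectations over a finite partition *)

Section expectation_partition.
Context {R : realType} {d : measure_display} {T : measurableType d}.
Variables (P : probability T R) (N : nat) (E : 'I_N -> set T) (c : 'I_N -> R).
Hypotheses (mE : forall k, measurable (E k)) (tE : trivIset setT E).
Hypothesis sumE : (\sum_(k < N) P (E k) = 1)%E.

Lemma ae_partition : {ae P, forall w, exists k, E k w}.
Proof.
pose D := \big[setU/set0]_(k < N) E k.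
have mD : measurable D by apply: bigsetU_measurable.
have PD : P (~` D) = 0%E.
  rewrite probability_setC// measure_bigsetU_ord//.
  by apply/eqP; rewrite sube_eq ?add0e ?sumE.
exists (~` D); split => //; first exact: measurableC.
move=> w /= nE Dw; apply: nE.
move: Dw; rewrite /D; apply: (big_ind (fun A : set T => A w -> exists k, E k w)).
- by [].
- by move=> A B hA hB [/hA|/hB].
- by move=> k _ Ekw; exists k.
Qed.

Lemma sum_indic_partition k w : E k w -> \sum_(l < N) c l * \1_(E l) w = c k.
Proof.
move=> Ekw; rewrite (bigD1 k)//= indicE mem_set// mulr1 big1 ?addr0// => l lk.
rewrite indicE memNset ?mulr0// => Elw.
by move/eqP: lk; apply; apply: (tE I I); exists w.
Qed.

Lemma expectation_sum_indic :
  ('E_P[(fun w => \sum_(l < N) c l * \1_(E l) w)%R] = \sum_(k < N) (c k)%:E * P (E k))%E.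
Proof.
have int k : P.-integrable setT (fun w => (\1_(E k) w)%:E).
  by apply: integrable_indic => //; rewrite setTI fin_num_fun_lty// fin_num_measure.
rewrite unlock (eq_integral (fun w => \sum_(l < N) ((c l)%:E * (\1_(E l) w)%:E)%E)); last first.
  by move=> w _; rewrite -sumEFin; apply: eq_bigr => k _; rewrite EFinM.
rewrite integral_sum//; last by move=> k; exact: integrableZl.
by apply: eq_bigr => k _; rewrite integralZl// integral_indic// setIT.
Qed.

(** Applied on the spaces of the chain and of [Z], this reduces the equality of
two expectations to that of the probabilities of the cells. *)
Lemma expectation_partition (Y : T -> R) : measurable_fun setT Y ->
  {ae P, forall w k, E k w -> Y w = c k} ->
  ('E_P[Y] = \sum_(k < N) (c k)%:E * P (E k))%E.
Proof.
move=> mY YE; rewrite -expectation_sum_indic unlock; apply: ae_eq_integral => //.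
- exact/measurable_EFinP.
- apply/measurable_EFinP; apply: measurable_sum => k.
  by apply: measurable_funM => //; exact: measurable_indic.
- apply: filterS2 YE ae_partition => w h [k Ekw] _.
  by rewrite (sum_indic_partition Ekw) (h k).
Qed.

End expectation_partition.

(** * Law of the chain *)

Section chain_law.
Context {R : realType}.
Variables (U b mu : R).
Hypotheses (U_gt0 : 0 < U) (b_gt0 : 0 < b) (mu_gt0 : 0 < mu) (mu_ltU : mu < U).
Variable T : nat.
Hypothesis gT : (preGamma U b mu T < T)%N.
Notation L := (preLambda U b mu T).
Notation D := (preD U b mu T).
Notation X := (preX U b mu T).
Notation scen := (scenario U b mu T).

(** At [t < k] the value is the survival probability after step [t]. *)
Definition scenario_prob (k t : nat) : R :=
  if (t < k)%N then mu / D t else mu / D k.-1 - mu / D k.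

Lemma two_point1 (p : R) (x y v : R * R) :
  two_point p x y [set v] = (p * (x == v)%:R + (1 - p) * (y == v)%:R)%:E.
Proof.
by rewrite /two_point !diracE !in_set1 -!EFinM -EFinD.
Qed.

Lemma scenario_lt k t : (t < k)%N -> (t <= L)%N -> scen k t = (X t, D t).
Proof. by move=> tk tL; rewrite /scenario leqNgt tk/= /alive_path tL. Qed.

Lemma scenario_ge k t : (k <= t)%N -> (k <= L)%N -> scen k t = (X k, 0).
Proof. by rewrite /scenario => -> ->. Qed.

Context {d} {Omega : measurableType d} (P : probability Omega R).
Variable M : nat -> Omega -> R * R.
Hypothesis M_chain : is_chain U b mu T P M.

Definition follows (k t : nat) : set Omega :=
  \bigcap_(i in [set i | (1 <= i <= t)%N]) M i @^-1` [set scen k i].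

Lemma measurable_pair1 (v : R * R) : measurable [set v].
Proof.
rewrite (_ : [set v] = [set v.1] `*` [set v.2]).
  by apply: measurableX; exact: measurable_set1.
by apply/seteqP; split => [_ ->|[a c] /= [-> ->]] //=; case: v.
Qed.

Lemma measurable_follows k t : measurable (follows k t).
Proof.
have [mM _ _ _] := M_chain.
apply: bigcap_measurableType.
move=> i /= /andP[i1 _].
by rewrite -[X in measurable X]setTI; apply: mM => //; exact: measurable_pair1.
Qed.

Lemma followsE k t w : follows k t w <-> forall i, (1 <= i <= t)%N -> M i w = scen k i.
Proof. by []. Qed.

(** On the event of following the scenario up to [t] the transition kernel is
evaluated at a fixed point, so each step multiplies the probability by a
constant. *)
Lemma probability_follows k t : (0 < t <= L)%N -> (0 < k)%N ->
  P (follows k t) = (scenario_prob k t)%:E.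
Proof.
have [mM init step _] := M_chain.
have Dn i : (i <= L)%N -> D i != 0.
  by move=> iL; rewrite gt_eqF// preD_gt0.
have nD i x : (i <= L)%N -> ((x, D i) == (x, 0) :> R * R) = false.
  by move=> iL; rewrite xpair_eqE eqxx (negbTE (Dn i iL)).
have nD' i x : (i <= L)%N -> ((x, 0) == (x, D i) :> R * R) = false.
  by move=> iL; rewrite eq_sym nD.
move=> /andP[] + + k0; elim: t => // t IH _ tL.
have [t0|t0] := posnP t.
  rewrite t0 in tL *.
  have -> : follows k 1 = M 1%N @^-1` [set scen k 1].
    apply/seteqP; split => [w h|w h i /=]; first by apply: h => /=.
    by rewrite -eqn_leq => /eqP <-.
  rewrite init; last exact: measurable_pair1.
  rewrite /pre_init two_point1 /scenario_prob; case: ltnP => k1.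
    by rewrite scenario_lt// eqxx nD'// mulr0 addr0 mulr1.
  have -> : k = 1%N by apply/eqP; rewrite eqn_leq k1.
  by rewrite scenario_ge// eqxx nD// mulr0 add0r mulr1 preD0 divff// gt_eqF.
have tL' : (t <= L)%N := ltnW tL.
have := step t.+1 _ (fun i => [set scen k i]).
rewrite ltnS t0 tL => /(_ isT (fun i => measurable_pair1 _)).
rewrite -/(follows k t.+1) => ->.
have cst w : follows k t w -> pre_trans U b mu T t.+1 (M t w) [set scen k t.+1] =
    pre_trans U b mu T t.+1 (scen k t) [set scen k t.+1].
  by move=> h; rewrite h//= t0/=.
rewrite -[X in (\int[_]_(_ in X) _)%E]/(follows k t).
rewrite (eq_integral (fun w => pre_trans U b mu T t.+1 (scen k t) [set scen k t.+1])); last first.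
  by move=> w; rewrite inE => /cst.
rewrite integral_cst; last exact: measurable_follows.
rewrite [X in (_ * X)%E](IH t0 tL') /pre_trans /scenario_prob.
have [tk|kt] := ltnP t k.
  rewrite (scenario_lt tk tL') /= (negbTE (Dn t tL')) two_point1.
  have [tk1|kt1] := ltnP t.+1 k.
    rewrite scenario_lt// eqxx nD'// mulr0 addr0 mulr1 -EFinM; congr EFin.
    by field; rewrite !Dn.
  have -> : k = t.+1 by apply/eqP; rewrite eqn_leq kt1.
  rewrite scenario_ge// eqxx nD// mulr0 add0r mulr1 -EFinM; congr EFin.
  by rewrite /=; field; rewrite !Dn.
have kL : (k <= L)%N := leq_trans kt tL'.
rewrite ltnNge (leqW kt)/= (scenario_ge kt kL) /= eqxx (scenario_ge (leqW kt) kL).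
by rewrite diracE mem_set// mul1e.
Qed.

Lemma follows_trivIset : trivIset setT (fun k : 'I_L.+1 => follows k.+1 L).
Proof.
suff H (i j : 'I_L.+1) w : (i < j)%N -> follows i.+1 L w -> follows j.+1 L w -> False.
  move=> i j _ _ [w [hi hj]].
  case: (ltngtP i j) => [ij|ji|/val_inj//]; first by have := H i j w ij hi hj.
  by have := H j i w ji hj hi.
move=> ij /followsE hi /followsE hj.
have iL : (i < L)%N by rewrite -ltnS (leq_ltn_trans ij).
have := hi i.+1; rewrite (hj i.+1)// ltnS iL => /(_ isT).
rewrite scenario_lt ?ltnS// scenario_ge// => -[] /eqP.
by rewrite gt_eqF// preD_gt0.
Qed.

Lemma sum_scenario_prob : \sum_(k < L.+1) scenario_prob k.+1 L = 1.
Proof.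
have L0 := preLambda_gt0 gT.
rewrite big_ord_recr/= {2}/scenario_prob ltnSn.
rewrite (eq_bigr (fun k : 'I_L => - (mu / D k.+1) - - (mu / D k))); last first.
  move=> k _; rewrite /scenario_prob ltnNge ltn_ord/= opprK addrC//.
rewrite -(big_mkord xpredT (fun k => - (mu / D k.+1) - - (mu / D k))).
by rewrite telescope_sumr// opprK addrAC addNr add0r preD0 divff// gt_eqF.
Qed.

(** After [preLambda] the chain is almost surely determined by its value at
[preLambda], with one exceptional null set for each of the countably many
later steps. *)
Lemma follows_forever (k : 'I_L.+1) :
  {ae P, forall w, follows k.+1 L w -> forall t, (0 < t)%N -> M t w = scen k.+1 t}.
Proof.
have [_ _ _ late] := M_chain.
have : {ae P, forall w, forall t, (L < t)%N ->
        ((M L w).2 = 0 -> M t w = ((M L w).1, 0)) /\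
        ((M L w).2 = U -> M t w = (U, U))}.
  apply: ae_foralln => t; have [tL|Lt] := leqP t L.
    by apply: aeW => w.
  by apply: filterS (late _ Lt) => w h _.
apply: filterS => w h fw t t0.
have [tL|Lt] := leqP t L; first by apply: fw => /=; rewrite t0 tL.
have L0 := preLambda_gt0 gT.
have := fw L; rewrite /= L0 leqnn => /(_ isT) /= ML.
have [h1 h2] := h _ Lt.
have [kL|Lk] := ltnP k L.
  by rewrite h1 ML !scenario_ge// (leq_trans kL)// ltnW.
rewrite h2; last by rewrite ML scenario_lt//= (preD_Lambda U_gt0).
by rewrite /scenario [(k.+1 <= L)%N]leqNgt ltnS Lk andbF /alive_path leqNgt Lt.
Qed.

End chain_law.

(** * Law of the limit jump time *)

Section law_of_Z.
Context {R : realType}.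
Variables (U b mu : R).
Hypotheses (U_gt0 : 0 < U) (b_gt0 : 0 < b) (mu_gt0 : 0 < mu) (mu_ltU : mu < U).
Notation Lam := (limLambda U b mu).

Lemma is_derive_onem_powR (p x : R) : x < 1 ->
  is_derive x 1 (fun y : R => (1 - y) `^ p) (- (p * (1 - x) `^ (p - 1))).
Proof.
move=> x1; have x0 : 0 < 1 - x by rewrite subr_gt0.
have dg : is_derive x (1 : R) (fun y : R => 1 - y) (- 1).
  apply: is_derive_eq. by rewrite add0r mul1r.
have df := is_derive1_powR p x0.
have := @is_derive1_comp _ (fun y : R => y `^ p) (fun y : R => 1 - y) x _ _ df dg.
by rewrite mulrN1.
Qed.

Lemma cvg_onem_powR (p x : R) : x < 1 ->
  (1 - y) `^ p @[y --> x] --> (1 - x) `^ p.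
Proof.
move=> x1; have [+ _] := is_derive_onem_powR p x1.
by move=> /derivable1_diffP/differentiable_continuous.
Qed.

(** [- (1 - x) `^ b] is a primitive of the density; the possible
singularity at [1] lies outside the interval because [c < 1]. *)
Lemma integral_density (a c : R) : a <= c -> c < 1 ->
  (\int[lebesgue_measure]_(x in `[a, c[) (b * (1 - x) `^ (b - 1))%:E
   = ((1 - a) `^ b - (1 - c) `^ b)%:E)%E.
Proof.
rewrite le_eqVlt => /orP[/eqP <- _|ac c1].
  by rewrite set_itvco0 ?lexx// integral_set0 subrr.
have lt1 x : x <= c -> x < 1 by move=> /le_lt_trans; apply.
have cf : {in `[a, c], forall x, {for x, continuous (fun x : R => b * (1 - x) `^ (b - 1))}}.
  move=> x; rewrite in_itv/= => /andP[_ /lt1 x1].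
  by apply: cvgM; [exact: cvg_cst|exact: cvg_onem_powR].
have cw : {within `[a, c], continuous (fun x : R => b * (1 - x) `^ (b - 1))}.
  apply: continuous_in_subspaceT => x; rewrite inE => xac; exact: cf.
rewrite integral_itv_bndo_bndc; last first.
  apply/measurable_EFinP; apply: subspace_continuous_measurable_fun => //.
  by apply: continuous_subspaceW cw; apply: subset_itvl; rewrite bnd_simp.
rewrite (@continuous_FTC2 _ _ (fun x => - (1 - x) `^ b))//.
- by rewrite -EFinB opprK addrC.
- split.
  + move=> x; rewrite in_itv/= => /andP[_ /ltW/lt1 x1].
    have [? _] := is_derive_onem_powR b x1; exact: derivableN.
  + by apply: cvg_at_right_filter; apply: cvgN; apply: cvg_onem_powR; rewrite lt1// ltW.
  + by apply: cvg_at_left_filter; apply: cvgN; apply: cvg_onem_powR.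
- move=> x; rewrite in_itv/= => /andP[_ /ltW/lt1 x1].
  have dx := is_derive_onem_powR b x1; have [? _] := dx.
  by rewrite derive1E deriveN// derive_val opprK.
Qed.

Context {d} {Omega : measurableType d} (P : probability Omega R) (Z : Omega -> R).
Hypothesis Z_dist : forall A : set R, measurable A -> P (Z @^-1` A) = Z_law U b mu A.

Lemma limLambda_gt0 : 0 < Lam.
Proof.
have one : (1 : R) `^ b^-1 = 1 by rewrite powR1.
rewrite subr_gt0 -[ltRHS]one gt0_ltr_powR ?nnegrE ?invr_gt0//.
  by rewrite divr_ge0 ?ltW.
by rewrite ltr_pdivrMr// mul1r.
Qed.

Lemma prob_Z_itv (a c : R) : 0 <= a -> a <= c -> c <= Lam ->
  P (Z @^-1` `[a, c[) = ((1 - a) `^ b - (1 - c) `^ b)%:E.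
Proof.
move=> a0 ac cL; rewrite Z_dist// /Z_law.
rewrite (_ : `[a, c[ `&` `[0, Lam[ = `[a, c[%classic); last first.
  apply/setIidPl => x /=; rewrite !in_itv/= => /andP[ax xc].
  by rewrite (le_trans a0)//= (lt_le_trans xc).
rewrite integral_density//; last by rewrite (le_lt_trans cL)// limLambda_lt1.
rewrite diracE memNset ?mule0 ?adde0//= in_itv/= => /andP[_].
by rewrite ltNge cL.
Qed.

Lemma prob_Z_limLambda : P (Z @^-1` [set Lam]) = (mu / U)%:E.
Proof.
rewrite Z_dist// /Z_law (_ : [set Lam] `&` _ = set0); last first.
  by apply/seteqP; split => // x [-> /=]; rewrite in_itv/= ltxx andbF.
by rewrite integral_set0 add0e diracE mem_set// mule1.
Qed.

Lemma prob_Z_0 : P (Z @^-1` [set 0]) = 0%E.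
Proof.
have L0 := limLambda_gt0.
rewrite Z_dist// /Z_law (_ : [set 0] `&` _ = [set 0]); last first.
  by apply/setIidPl => x -> /=; rewrite in_itv/= lexx L0.
rewrite integral_set1 diracE memNset ?mule0 ?adde0//= => LE.
by rewrite -LE ltxx in L0.
Qed.

End law_of_Z.

(** * Borel measurability of random paths *)

Section borel.
Context {R : realType}.

Lemma borel_measurable_open {d} {Omega : measurableType d} {S : ptopologicalType}
    (Y : Omega -> S) :
  (forall G : set S, open G -> measurable (Y @^-1` G)) -> borel_measurable Y.
Proof.
move=> h.
apply: (@measurability _ _ Omega (g_sigma_algebraType (@open S)) setT Y (@open S)) => // _ [G openG <-].
by rewrite setTI; exact: h.
Qed.

Lemma borel_measurable_comp {d} {Omega : measurableType d} {S : ptopologicalType}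
    (Y : Omega -> S) (f : S -> R) :
  borel_measurable Y -> continuous f -> measurable_fun setT (f \o Y).
Proof.
move=> mY cf.
apply: (@measurability _ _ Omega _ setT (f \o Y) _ (RGenOInfty.measurableE R)).
move=> _ [_ [x ->] <-]; rewrite comp_preimage.
apply: mY => //; apply: sub_sigma_algebra.
by apply: open_comp => [s _|]; [exact: cf|exact: interval_open].
Qed.

Lemma J1_ball_le {V : normedModType R} (x y : skorokhod V) (r e : R) :
  0 <= r -> r < e -> (forall t : R, t \in `[0, 1] -> `|x t - y t| <= r) ->
  J1_ball x e y.
Proof.
move=> r0 re xy; exists id; first exact: time_change_id.
by exists r => // t t01; rewrite subrr normr0; split => //; exact: xy.
Qed.

Lemma step_itv (T : nat) (t : R) : (0 < T)%N -> t \in `[0, 1] ->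
  (0 < maxn (Num.truncn (t * T%:R)) 1 <= T)%N.
Proof.
rewrite in_itv/= => T0 /andP[t0 t1]; rewrite leq_max orbT geq_max T0 andbT.
have /truncn_itv/andP[h _] : 0 <= t * T%:R by rewrite mulr_ge0.
by rewrite -(ler_nat R) (le_trans h)// ler_piMl.
Qed.

(** The path depends continuously on the first [T] values, with the identity as
time change. *)
Lemma J1_ball_pre_path (T : nat) (m m' : nat -> R * R) (r e : R) : (0 < T)%N ->
  0 <= r -> r < e -> (forall t, (0 < t <= T)%N -> `|m t - m' t| <= r) ->
  J1_ball (pre_path T m) e (pre_path T m').
Proof.
move=> T0 r0 re mm'; apply: (J1_ball_le r0 re) => t t01.
rewrite !pre_pathE// /pre_fun; apply: mm'.
exact: step_itv.
Qed.

Lemma pre_path_eq (T : nat) (m m' : nat -> R * R) : (0 < T)%N ->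
  (forall t, (0 < t <= T)%N -> m t = m' t) -> pre_path T m = pre_path T m'.
Proof.
move=> T0 mm'; rewrite /pre_path /skorokhod_of.
have E : restr01 (pre_fun T m) = restr01 (pre_fun T m').
  apply/funext => t; rewrite /restr01; case: ifPn => // t01.
  exact/mm'/step_itv.
move: (restr01_cadlag _) (restr01_cadlag _) (@restr01_out _ _ _) (@restr01_out _ _ _).
rewrite E => c1 c2 o1 o2.
by rewrite (Prop_irrelevance c1 c2) (Prop_irrelevance o1 o2).
Qed.

Lemma measurable_ball_pair (q : R * R) (r : R) :
  measurable [set v : R * R | `|v - q| < r].
Proof.
rewrite (_ : [set _ | _] = [set v | `|v - q.1| < r] `*` [set v | `|v - q.2| < r]).
  have h (c : R) : measurable [set v : R | `|v - c| < r].
    apply: open_measurable; rewrite (_ : [set _ | _] = ball c r).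
      exact: ball_open.
    by apply/seteqP; split => v; rewrite /ball/= distrC.
  by apply: measurableX; exact: h.
apply/seteqP; split => [v|v] /=; rewrite prod_normE gt_max/=; first by move=> /andP.
by move=> [-> ->].
Qed.

Lemma rat_pair_approx (v : R * R) (r : R) : 0 < r ->
  exists q : rat * rat, `|v - (ratr q.1, ratr q.2)| < r.
Proof.
move=> r0; have h (x : R) : exists q : rat, `|x - ratr q| < r.
  have /rat_in_itvoo[q] : x - r < x + r by lra.
  rewrite in_itv/= => /andP[q1 q2]; exists q.
  by rewrite ltr_norml; apply/andP; split; lra.
have [q1 h1] := h v.1; have [q2 h2] := h v.2.
by exists (q1, q2); rewrite prod_normE gt_max/= h1 h2.
Qed.

(** The set of value vectors whose path lies in an open set is open, hence a
countable union of boxes with rational centres. *)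
Lemma pre_path_measurable {d} {Omega : measurableType d} (T : nat)
    (M : nat -> Omega -> R * R) : (0 < T)%N ->
  (forall t, (0 < t)%N -> measurable_fun setT (M t)) ->
  borel_measurable (fun w => pre_path T (fun t => M t w)).
Proof.
move=> T0 mM; apply: borel_measurable_open => G openG.
pose I := ({ffun 'I_T.+1 -> rat * rat} * nat)%type.
pose c (i : I) t : R * R := (ratr (i.1 (inord t)).1, ratr (i.1 (inord t)).2).
(* box of radius [i.2.+1^-1] around the rational centre [i.1] *)
pose B (i : I) := [set m : nat -> R * R |
  forall t, (0 < t <= T)%N -> `|m t - c i t| < i.2.+1%:R^-1].
pose F (i : I) := if `[< forall m, B i m -> G (pre_path T m) >] then
  \bigcap_(t in [set t | (0 < t <= T)%N])
    M t @^-1` [set v | `|v - c i t| < i.2.+1%:R^-1] else set0.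
rewrite [X in measurable X](_ : _ = \bigcup_i F i).
  apply: countable_bigcupT_measurable => [|i]; first exact: countableP.
  rewrite /F; case: ifPn => // _; apply: bigcap_measurableType => t /andP[t0 _].
  by rewrite -[X in measurable X]setTI; apply: mM => //; exact: measurable_ball_pair.
apply/seteqP; split => w; last first.
  move=> [i _]; rewrite /F; case: ifPn => // /asboolP h Fw.
  by apply: (h (fun t => M t w)) => t tT; exact: Fw.
move=> /= Ow.
have : nbhs (pre_path T (fun t => M t w)) G by exact: open_nbhs_nbhs.
move=> [e /= e0 eO].
have [n nE] : exists n : nat, 2 * n.+1%:R^-1 < e.
  have e2 : 0 < e / 2 by rewrite divr_gt0.
  have [n hn] := ltr_add_invr e2.
  by exists n; move: hn; rewrite add0r ltr_pdivlMr// mulrC.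
have n0 : 0 < n.+1%:R^-1 :> R by rewrite invr_gt0.
have /choice[q hq] : forall t : 'I_T.+1, exists q : rat * rat,
    `|M t w - (ratr q.1, ratr q.2)| < n.+1%:R^-1.
  by move=> t; exact: rat_pair_approx.
have hc t : (0 < t <= T)%N -> `|M t w - c (finfun q, n) t| < n.+1%:R^-1.
  by move=> /andP[_ tT]; rewrite /c ffunE /=; have := hq (inord t); rewrite inordK.
exists (finfun q, n) => //; rewrite /F ifT.
  by move=> t tT /=; exact: hc.
apply/asboolP => m mB; apply: eO.
apply: (J1_ball_pre_path T0 _ nE); first by rewrite mulr_ge0// ltW.
move=> t tT; rewrite -(subrKA (c (finfun q, n) t)).
apply: le_trans (ler_normD _ _) _; rewrite mulr_natl mulr2n.
apply: lerD; first by apply: ltW; exact: hc.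
by rewrite distrC ltW//; exact: mB.
Qed.

Variables (U b mu : R).
Hypotheses (U_gt0 : 0 < U) (b_gt0 : 0 < b) (mu_gt0 : 0 < mu) (mu_ltU : mu < U).
Notation Lam := (limLambda U b mu).

(** An open set of paths pulls back to an open set of jump times inside
[]0, limLambda[], plus possibly one or both end points. *)
Lemma lim_path_measurable {d} {Omega : measurableType d} (Z : Omega -> R)
  (mZ : measurable_fun setT Z) (Z_range : forall w, 0 <= Z w <= Lam) :
  borel_measurable (fun w => lim_path U_gt0 mu_gt0 (Z_range w)).
Proof.
apply: borel_measurable_open => G openG.
pose A := [set z : R | exists z0L : 0 <= z <= Lam, G (lim_path U_gt0 mu_gt0 z0L)].
rewrite [X in measurable X](_ : _ = Z @^-1` A); last first.
  apply/seteqP; split => w /=; first by exists (Z_range w).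
  by move=> [zL]; rewrite (bool_irrelevance (Z_range w) zL).
rewrite -[X in measurable X]setTI; apply: mZ => //.
have mA1 (x : R) : measurable (A `&` [set x]).
  have [Ax|Ax] := pselect (A x).
    by rewrite setIidr; [exact: measurable_set1|move=> _ ->].
  rewrite (_ : _ `&` _ = set0)//.
  by apply/seteqP; split => // y [+ yx]; rewrite yx.
(* at the two end points the limit path is not continuous in the jump time,
   but single points are measurable *)
rewrite (_ : A = (A `&` `]0, Lam[) `|` (A `&` [set 0]) `|` (A `&` [set Lam])).
  apply: measurableU => //; apply: measurableU => //.
  apply: open_measurable; rewrite openE => z [[z0L Oz] /=].
  rewrite in_itv/= => z0L'.
  have : nbhs (lim_path U_gt0 mu_gt0 z0L) G by exact: open_nbhs_nbhs.
  move=> [e /= e0 eO]; have [z0 zL] := andP z0L'.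
  near=> z'.
  have z'0L : 0 < z' < Lam.
    by apply/andP; split; near: z'; [exact: lt_nbhsr|exact: lt_nbhsl].
  split; last by rewrite /= in_itv.
  have z'0L' : 0 <= z' <= Lam by case/andP: z'0L => /ltW -> /ltW ->.
  exists z'0L'; apply: eO; move: z'0L'; near: z'.
  exact: lim_path_near.
rewrite -!setIUr setIidl// => z [/andP[+ +] _]; rewrite le_eqVlt => /orP[/eqP <- _|z0].
  by left; right.
rewrite le_eqVlt => /orP[/eqP ->|zL]; first by right.
by left; left; rewrite /= in_itv/= z0.
Unshelve. all: by end_near. Qed.

End borel.

(** * Coupling on the probability space of the limit *)

Section coupling.
Context {R : realType}.
Variables (U b mu : R).
Hypotheses (U_gt0 : 0 < U) (b_gt0 : 0 < b) (mu_gt0 : 0 < mu) (mu_ltU : mu < U).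
Notation Lam := (limLambda U b mu).

(** When [preGamma < T] the bins partition [[0, limLambda]]; the last one is the
atom of [Z]. *)
Definition jump_bin (T k : nat) : set R :=
  if (k < preLambda U b mu T)%N then `[lim_time U b mu T k, lim_time U b mu T k.+1[%classic
  else [set Lam].

Lemma measurable_jump_bin T k : measurable (jump_bin T k).
Proof. by rewrite /jump_bin; case: ifP => _; [exact: measurable_itv|exact: measurable_set1]. Qed.

Context {d} {Omega : measurableType d} (P : probability Omega R) (Z : Omega -> R).
Hypotheses (mZ : measurable_fun setT Z) (Z_range : forall w, 0 <= Z w <= Lam).
Hypothesis Z_dist : forall A : set R, measurable A -> P (Z @^-1` A) = Z_law U b mu A.

Section fixed_horizon.
Variable T : nat.
Hypothesis gT : (preGamma U b mu T < T)%N.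
Notation L := (preLambda U b mu T).
Notation E := (fun k : 'I_L.+1 => Z @^-1` (jump_bin T k)).

Lemma measurable_jump_event k : measurable (Z @^-1` (jump_bin T k)).
Proof.
rewrite -[X in measurable X]setTI; apply: mZ => //; exact: measurable_jump_bin.
Qed.

Lemma prob_jump_event (k : 'I_L.+1) : P (E k) = (scenario_prob U b mu T k.+1 L)%:E.
Proof.
rewrite /jump_bin /scenario_prob.
case: ltnP => kL; last first.
  rewrite prob_Z_limLambda// (preD_Lambda U_gt0 b_gt0 mu_gt0 mu_ltU gT).
  by rewrite ltnS leqNgt ltnNge kL.
have [z0 _] := andP (lim_time_itv U_gt0 b_gt0 mu_gt0 mu_ltU gT (ltnW kL)).
have [_ zL] := andP (lim_time_itv U_gt0 b_gt0 mu_gt0 mu_ltU gT kL).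
rewrite (prob_Z_itv U_gt0 mu_gt0 Z_dist) ?lim_time_le ?leqnSn//.
by rewrite !onem_lim_time_powR ?(ltnW kL)//= ltnS leqNgt kL.
Qed.

Lemma jump_event_trivIset : trivIset setT E.
Proof.
suff H (i j : 'I_L.+1) w : (i < j)%N -> E i w -> E j w -> False.
  move=> i j _ _ [w [hi hj]].
  case: (ltngtP i j) => [ij|ji|/val_inj//]; first by have := H i j w ij hi hj.
  by have := H j i w ji hj hi.
move=> ij; have iL : (i < L)%N by rewrite -ltnS (leq_ltn_trans ij).
rewrite /= /jump_bin iL /= in_itv/= => /andP[_ zi]; case: ltnP => jL /=.
  rewrite in_itv/= => /andP[zj _].
  have zij : lim_time U b mu T i.+1 <= lim_time U b mu T j.
    by apply: lim_time_le => //; rewrite ij ltnW.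
  by have := lt_le_trans zi (le_trans zij zj); rewrite ltxx.
move=> ZE; rewrite ZE in zi.
have [_] := andP (lim_time_itv U_gt0 b_gt0 mu_gt0 mu_ltU gT iL).
by rewrite leNgt zi.
Qed.

Lemma jump_event_cover w : exists k, E k w.
Proof.
have /andP[Z0] := Z_range w; rewrite le_eqVlt => /orP[/eqP ZL|ZL].
  by exists ord_max; rewrite /= /jump_bin ltnn.
have ex : exists k, (k <= L)%N && (Z w < lim_time U b mu T k).
  by exists L; rewrite leqnn (lim_time_Lambda U_gt0).
have [k /andP[kL Zk] kmin] := ex_minnP ex.
case: k kL Zk kmin => [|k] kL Zk kmin.
  by move: Zk; rewrite lim_time0// ltNge Z0.
exists (Ordinal (ltnW kL : (k < L.+1)%N)); rewrite /= /jump_bin kL /= in_itv/= Zk andbT.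
rewrite leNgt; apply/negP => Zk'.
by have := kmin k; rewrite (ltnW kL) Zk' ltnn => /(_ isT).
Qed.

Lemma sum_prob_jump_event : (\sum_(k < L.+1) P (E k) = 1)%E.
Proof.
rewrite (eq_bigr (fun k : 'I_L.+1 => (scenario_prob U b mu T k.+1 L)%:E)).
  by rewrite sumEFin sum_scenario_prob.
by move=> k _; exact: prob_jump_event.
Qed.

End fixed_horizon.

Variable f : skorokhod (R * R)%type -> R.
Hypothesis cf : continuous f.

(** The value of [f] along the scenario selected by the bin containing [Z w].
For the finitely many [T] with [preGamma = T] the value [0] keeps
[coupled_bound] true. *)
Definition coupled (T : nat) (w : Omega) : R :=
  if (preGamma U b mu T < T)%N then
    \sum_(k < (preLambda U b mu T).+1)
      f (pre_path T (scenario U b mu T k.+1)) * \1_(Z @^-1` (jump_bin T k)) w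
  else 0.

Lemma coupledE T (k : 'I_(preLambda U b mu T).+1) w :
  (preGamma U b mu T < T)%N -> jump_bin T k (Z w) ->
  coupled T w = f (pre_path T (scenario U b mu T k.+1)).
Proof.
move=> gT Zk; rewrite /coupled gT.
exact: (sum_indic_partition (fun l : 'I_(preLambda U b mu T).+1 =>
  f (pre_path T (scenario U b mu T l.+1))) (jump_event_trivIset gT) (k := k)).
Qed.

Lemma measurable_coupled T : measurable_fun setT (coupled T).
Proof.
rewrite /coupled; case: (preGamma U b mu T < T)%N => //; apply: measurable_sum => k.
apply: measurable_funM => //; apply: measurable_indic.
exact: measurable_jump_event.
Qed.

(** The cells on both sides have the same probabilities, by [probability_follows]
and [prob_jump_event]. *)
Lemma expectation_coupled {d'} {Omega' : measurableType d'}
    (P' : probability Omega' R) (M : nat -> Omega' -> R * R) T :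
  (preGamma U b mu T < T)%N -> is_chain U b mu T P' M ->
  ('E_P'[f \o (fun w => pre_path T (fun t => M t w))] = 'E_P[coupled T])%E.
Proof.
move=> gT M_chain; have [mM _ _ _] := M_chain.
have T0 : (0 < T)%N by apply: leq_ltn_trans gT.
have L0 := preLambda_gt0 gT.
pose c (k : 'I_(preLambda U b mu T).+1) := f (pre_path T (scenario U b mu T k.+1)).
have PF (k : 'I_(preLambda U b mu T).+1) :
    P' (follows U b mu T M k.+1 (preLambda U b mu T)) =
    (scenario_prob U b mu T k.+1 (preLambda U b mu T))%:E.
  by rewrite (probability_follows U_gt0 b_gt0 mu_gt0 mu_ltU gT M_chain)// L0 leqnn.
transitivity (\sum_(k < (preLambda U b mu T).+1)
    (c k)%:E * (scenario_prob U b mu T k.+1 (preLambda U b mu T))%:E)%E.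
  rewrite (@expectation_partition _ _ _ P' _
    (fun k => follows U b mu T M k.+1 (preLambda U b mu T)) c).
  - by apply: eq_bigr => k _; rewrite PF.
  - by move=> k; exact: (measurable_follows M_chain).
  - exact: follows_trivIset.
  - by rewrite (eq_bigr _ (fun k _ => PF k)) sumEFin sum_scenario_prob.
  - apply: borel_measurable_comp => //; exact: pre_path_measurable.
  - apply: filter_forall => k.
    apply: filterS (follows_forever U_gt0 b_gt0 mu_gt0 mu_ltU gT M_chain k) => w h Fw /=.
    by rewrite (@pre_path_eq _ T _ (scenario U b mu T k.+1))// => t /andP[t0 _]; exact: h.
rewrite (@expectation_partition _ _ _ P _ (fun k : 'I_(preLambda U b mu T).+1 =>
  Z @^-1` (jump_bin T k)) c).
- by apply: eq_bigr => k _; rewrite prob_jump_event.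
- by move=> k; exact: measurable_jump_event.
- exact: jump_event_trivIset.
- exact: sum_prob_jump_event.
- exact: measurable_coupled.
- by apply: aeW => w k /= Zk; rewrite (coupledE gT Zk).
Qed.

Variable C : R.
Hypothesis f_bound : forall s, `|f s| <= C.

Lemma coupled_bound T w : `|coupled T w| <= C.
Proof.
have [gT|gT] := ltnP (preGamma U b mu T) T.
  by have [k Zk] := jump_event_cover gT w; rewrite (coupledE gT Zk).
rewrite /coupled ltnNge gT/= normr0.
exact: le_trans (normr_ge0 (f point)) (f_bound _).
Qed.

Lemma cvg_coupled w : Z w != 0 ->
  coupled n w @[n --> \oo] --> f (lim_path U_gt0 mu_gt0 (Z_range w)).
Proof.
move=> Z0; have [Zge0 ZL] := andP (Z_range w).
have Zgt0 : 0 < Z w by rewrite lt_neqAle eq_sym Z0.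
have [K K0 lip] := limX_lip U_gt0 b_gt0 mu_gt0.
apply/cvgrPdist_lt => eps eps0.
have /cvgrPdist_lt/(_ eps eps0) :
    f s @[s --> lim_path U_gt0 mu_gt0 (Z_range w)] -->
    f (lim_path U_gt0 mu_gt0 (Z_range w)) by exact: cf.
move=> [e /= e0 He].
pose K1 := 4 * K + 2.
have K10 : 0 < K1 by rewrite addr_gt0// mulr_gt0.
(* the two bounds are the side conditions of [J1_ball_killed] *)
pose dlt := Num.min (Z w / 4) (e / K1 / 2).
have d0 : 0 < dlt by rewrite lt_min !divr_gt0.
have dZ : 2 * dlt < Z w.
  have : dlt <= Z w / 4 by rewrite ge_min lexx.
  lra.
have de : K1 * dlt < e.
  have : dlt <= e / K1 / 2 by rewrite ge_min lexx orbT.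
  rewrite -(ler_pM2l K10) => /le_lt_trans; apply.
  rewrite (_ : _ * _ = e / 2); first lra.
  by field; rewrite gt_eqF.
apply: filterS (prelimit_near U_gt0 b_gt0 mu_gt0 mu_ltU d0).
move=> T [g0 gT Te zerr Xerr].
have [k Zk] := jump_event_cover gT w.
rewrite (coupledE gT Zk); apply: He; apply: J1_ball_sym.
have [kL|Lk] := ltnP k (preLambda U b mu T).
  move: Zk; rewrite /= /jump_bin kL /= in_itv/= => Zk.
  apply: (J1_ball_killed _ b_gt0 _ mu_ltU g0 gT Te zerr Xerr K0 lip) => //.
  have /andP[_ /lt_le_trans] := Zk; apply.
  by have /andP[] := lim_time_itv U_gt0 b_gt0 mu_gt0 mu_ltU gT kL.
move: Zk; rewrite /= /jump_bin ltnNge Lk /= => ZE.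
move: (Z_range w); rewrite ZE => LL.
by apply: (J1_ball_alive _ b_gt0 _ mu_ltU gT Te zerr Xerr K0 lip).
Qed.

Lemma cvg_expectation_coupled :
  ('E_P[coupled n] @[n --> \oo] -->
   'E_P[f \o (fun w => lim_path U_gt0 mu_gt0 (Z_range w))])%E.
Proof.
rewrite unlock.
have mf : measurable_fun setT (f \o (fun w => lim_path U_gt0 mu_gt0 (Z_range w))).
  by apply: borel_measurable_comp => //; exact: lim_path_measurable.
have [] // := @dominated_convergence _ _ _ P setT measurableT
  (fun n w => (coupled n w)%:E)
  (fun w => (f (lim_path U_gt0 mu_gt0 (Z_range w)))%:E) (EFin \o cst C).
- by move=> n; apply/measurable_EFinP; exact: measurable_coupled.
- exact/measurable_EFinP.
- exists (Z @^-1` [set 0]); split.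
  + by rewrite -[X in measurable X]setTI; apply: mZ => //; exact: measurable_set1.
  + exact: (prob_Z_0 U_gt0 b_gt0 mu_gt0 mu_ltU Z_dist).
  + move=> w /= h; apply: contrapT => /eqP Z0; apply: h => _.
    by apply: cvg_EFin; [exact: nearW|exact: cvg_coupled].
- exact: finite_measure_integrable_cst.
- by apply: aeW => w n _; rewrite /= lee_fin coupled_bound.
Qed.

End coupling.

(** * Weak convergence *)

Theorem theorem4 (R : realType) (U b mu : R)
  (U_gt0 : 0 < U) (b_gt0 : 0 < b) (mu_gt0 : 0 < mu) (mu_ltU : mu < U)
  (d : nat -> measure_display) (Omega : forall T, measurableType (d T))
  (P : forall T, probability (Omega T) R)
  (M : forall T, nat -> Omega T -> R * R)
  (M_chain : forall T, (1 <= T)%N -> is_chain U b mu T (P T) (M T))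
  (d' : measure_display) (Omega' : measurableType d')
  (P' : probability Omega' R) (Z : Omega' -> R)
  (Z_meas : measurable_fun [set: Omega'] Z)
  (Z_range : forall w, 0 <= Z w <= limLambda U b mu)
  (Z_dist : forall A : set R, measurable A -> P' (Z @^-1` A) = Z_law U b mu A) :
  weak_cvg
    (fun n => P n.+1) (fun n w => pre_path n.+1 (fun t => M n.+1 t w))
    P' (fun w => lim_path U_gt0 mu_gt0 (Z_range w)).
Proof.
split.
- move=> n; have [mM _ _ _] := M_chain n.+1 (ltn0Sn n).
  exact: pre_path_measurable.
- exact: lim_path_measurable.
- move=> f cf [C f_bound].
  have := cvg_expectation_coupled (U_gt0 := U_gt0) b_gt0 (mu_gt0 := mu_gt0) mu_ltU
    Z_meas (Z_range := Z_range) Z_dist cf f_bound.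
  rewrite -cvg_shiftS; apply: cvg_trans; apply: near_eq_cvg.
  have [N _ hN] := preGamma_lt_near b_gt0 mu_gt0 mu_ltU.
  exists N => // n /= Nn.
  have gn : (preGamma U b mu n.+1 < n.+1)%N by apply: hN => /=; exact: leqW.
  exact/esym/(expectation_coupled U_gt0 b_gt0 mu_gt0 mu_ltU Z_meas Z_dist cf gn
    (M_chain n.+1 (ltn0Sn n))).
Qed.
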